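(* Let $\Omega\subseteq\mathbb{R}^n$ be open. The map $\mathcal{B}^{\mathrm{c}}(\Omega)\to\mathcal{E}^e(\Omega)$, $R\mapsto R^e$, has the following properties: (i) $(\iota^{\mathrm{c}}u)^e=\iota^eu$ for $u\in\mathcal{D}'(\Omega)$. (ii) $(\sigma^{\mathrm{c}}f)^e=\sigma^ef$ for $f\in C^\infty(\Omega)$. (iii) $R^e\in\mathcal{E}^e_M(\Omega)$ for $R\in\mathcal{M}^{\mathrm{c}}(\Omega)$. (iv) $R^e\in\mathcal{N}^e(\Omega)$ for $R\in\mathcal{N}^{\mathrm{c}}(\Omega)$.
   Context: Notation: $\mathbb{N}=\{1,2,\dots\}$, $\mathbb{N}_0=\{0,1,\dots\}$, $\mathbb{R}^+=[0,\infty)$. $K\Subset L$ means that $K$ is compact and contained in the interior of $L$. $\mathcal{U}_x(\Omega)$ is the set of open neighborhoods of $x$ in $\Omega$; $\mathcal{D}(\mathbb{R}^n)$ is the space of (complex-valued) test functions, $\mathcal{D}'(\Omega)$ the space of distributions. $U(\Omega)=\{(\varphi,x)\in\mathcal{D}(\mathbb{R}^n)\times\Omega : x+\operatorname{supp}\varphi\subseteq\Omega\}$. $\mathcal{B}^{\mathrm{c}}(\Omega)$ is the set of all maps $R:U(\Omega)\to\mathbb{C}$ such that $R(\varphi,\cdot)$ is smooth (on the open set of $x$ with $(\varphi,x)\in U(\Omega)$) for each fixed $\varphi$. $(\iota^{\mathrm{c}}u)(\varphi,x)=\langle u,\varphi(\cdot-x)\rangle$, $(\sigma^{\mathrm{c}}f)(\varphi,x)=f(x)$.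 $\|g\|_{K,m}=\sup_{x\in K,|\alpha|\le m}|\partial^\alpha g(x)|$; $\|\varphi\|_c=\sup_{x\in\mathbb{R}^n,|\alpha|\le c}|\partial^\alpha\varphi(x)|$ for $\varphi\in\mathcal{D}(\mathbb{R}^n)$. For $\varphi\in\mathcal{D}(\mathbb{R}^n)$ let $\varphi^\star(x)(y)=\varphi(y-x)$, and let $\vec\delta(x)=\delta_x$; for $B$ a set of smooth functions, $\|\varphi^\star-\vec\delta\|_{K,c;B}=\sup_{x\in K,|\alpha|\le c,f\in B}\left|\int f(y)\,\partial_x^\alpha(\varphi(y-x))\,dy-\partial^\alpha f(x)\right|$. $\mathcal{P}_0=\mathbb{R}^+[y_0]$ (polynomials with coefficients in $\mathbb{R}^+$), $\mathcal{I}_0=\{\lambda\in\mathbb{R}^+[y_0,z_0] : \lambda(y_0,0)=0\}$. $R\in\mathcal{M}^{\mathrm{c}}(\Omega)$ iff $R\in\mathcal{B}^{\mathrm{c}}(\Omega)$ and $(\forall x\in\Omega)(\exists U\in\mathcal{U}_x(\Omega))(\forall K,L\Subset U: K\Subset L)(\forall m\in\mathbb{N}_0)(\exists c\in\mathbb{N}_0)(\exists\lambda\in\mathcal{P}_0)(\forall\varphi\in\mathcal{D}(\mathbb{R}^n): K+\operatorname{supp}\varphi\subseteq L)$: $\|R(\varphi,\cdot)\|_{K,m}\le\lambda(\|\varphi\|_c)$. $R\in\mathcal{N}^{\mathrm{c}}(\Omega)$ iff $R\in\mathcal{B}^{\mathrm{c}}(\Omega)$ and $(\forall x\in\Omega)(\exists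 U\in\mathcal{U}_x(\Omega))(\forall K,L\Subset U: K\Subset L)(\forall m\in\mathbb{N}_0)(\exists c\in\mathbb{N}_0)(\exists\lambda\in\mathcal{I}_0)(\exists B\subseteq C^\infty(U)\text{ bounded})(\forall\varphi\in\mathcal{D}(\mathbb{R}^n): K+\operatorname{supp}\varphi\subseteq L)$: $\|R(\varphi,\cdot)\|_{K,m}\le\lambda(\|\varphi\|_c,\|\varphi^\star-\vec\delta\|_{K,c;B})$. Colombeau's elementary algebra: for $k\in\mathbb{N}_0$, $\mathcal{A}_k(\mathbb{R}^n)$ is the set of all $\varphi\in\mathcal{D}(\mathbb{R}^n)$ with $\int\varphi=1$ and, if $k\ge1$, $\int x^\alpha\varphi(x)\,dx=0$ for $1\le|\alpha|\le k$. $S_\varepsilon\varphi(x)=\varepsilon^{-n}\varphi(x/\varepsilon)$. $O$-estimates are for $\varepsilon\to0$. $U^e(\Omega)=\{(\varphi,x)\in\mathcal{A}_0(\mathbb{R}^n)\times\Omega : x+\operatorname{supp}\varphi\subseteq\Omega\}$; $\mathcal{E}^e(\Omega)=\{R:U^e(\Omega)\to\mathbb{C} : R(\varphi,\cdot)\text{ is smooth for all }\varphi\in\mathcal{A}_0(\mathbb{R}^n)\}$; $\mathcal{E}^e_M(\Omega)=\{R\in\mathcal{E}^e(\Omega) : \forall K\Subset\Omega\ \forall m\in\mathbb{N}_0\ \exists N\in\mathbb{N}\ \forall\varphi\in\mathcal{A}_N(\mathbb{R}^n): \|R(S_\varepsilon\varphi,\cdot)\|_{K,m}=O(\varepsilon^{-N})\}$;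 $\mathcal{N}^e(\Omega)=\{R\in\mathcal{E}^e(\Omega) : \forall K\Subset\Omega\ \forall m\in\mathbb{N}_0\ \forall N\in\mathbb{N}\ \exists q\in\mathbb{N}\ \forall\varphi\in\mathcal{A}_q(\mathbb{R}^n): \|R(S_\varepsilon\varphi,\cdot)\|_{K,m}=O(\varepsilon^{N})\}$; $(\iota^eu)(\varphi,x)=\langle u,\varphi(\cdot-x)\rangle$, $(\sigma^ef)(\varphi,x)=f(x)$. The map: for $R\in\mathcal{B}^{\mathrm{c}}(\Omega)$, $R^e\in\mathcal{E}^e(\Omega)$ is defined by $R^e(\varphi,x)=R(\varphi,x)$ for $(\varphi,x)\in U^e(\Omega)$. *)

(* Defs.v *)
(* The real numbers are an arbitrary R : realType, points of R^n are row vectors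
   'rV[R]_n, and complex numbers are R[i]; derivatives and integrals of complex
   functions are taken on real and imaginary parts. *)
From HB Require Import structures.
From mathcomp Require Export all_boot all_order all_algebra.
From mathcomp Require Export complex.
From mathcomp Require Export all_classical all_reals all_analysis.
Export numFieldNormedType.Exports.

Set Implicit Arguments.
Unset Strict Implicit.
Unset Printing Implicit Defensive.
Import Order.TTheory GRing.Theory Num.Theory.
Local Open Scope classical_set_scope.
Local Open Scope complex_scope.
Local Open Scope ring_scope.

Definition compactly_in (T : topologicalType) (K L : set T) : Prop :=
  compact K /\ K `<=` L°.

Section lebesgue.
Variable R : realType.

Definition tuple_cons n
    (p : n.-tuple (measurableTypeR R) * measurableTypeR R) :
  n.+1.-tuple (measurableTypeR R) := [tuple of p.2 :: p.1].

Fact measurable_tuple_cons n : measurable_fun [set: _] (@tuple_cons n).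
Proof.
by apply: measurable_cons; [exact: measurable_snd|exact: measurable_fst].
Qed.

(* n-dimensional Lebesgue measure: the image under [tuple_cons] of the product
   of the n-dimensional one with the one-dimensional one.  R^n appears here as
   n.-tuple R because the library equips tuples, but not row vectors, with the
   product sigma-algebra. *)
Fixpoint lebesgue_tuple n :
    {measure set (n.-tuple (measurableTypeR R)) -> \bar R} :=
  if n is m.+1 then
    measure_function_pushforward__canonical__measure_function_Measure
      (lebesgue_tuple m \x lebesgue_measure)%E (@measurable_tuple_cons m)
  else \d_([tuple] : 0.-tuple (measurableTypeR R)).

End lebesgue.

Section spaces.
Variables (R : realType) (n : nat).
Local Notation V := 'rV[R]_n.
Local Notation C := R[i].

(* [Rintegral] is 0 on non-integrable functions; below, integrands are smooth
   and compactly supported. *)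
Definition integral_rV (f : V -> C) : C :=
  let intR (g : V -> R) :=
    (\int[@lebesgue_tuple R n]_t g (\row_j tnth t j))%R in
  intR (fun x => complex.Re (f x)) +i* intR (fun x => complex.Im (f x)).

Definition multi_index := {ffun 'I_n -> nat}.

Definition mdeg (a : multi_index) : nat := (\sum_(i < n) a i)%N.

Definition mono (a : multi_index) (x : V) : R := \prod_(i < n) x 0 i ^+ a i.

(* Iterated partial derivative along a word of coordinates; the head of the
   word is the last derivative taken. *)
Definition dword_re (w : seq 'I_n) (g : V -> R) : V -> R :=
  foldr (fun i h x => 'D_(delta_mx 0 i) h x) g w.

Definition dword (w : seq 'I_n) (f : V -> C) : V -> C := fun x =>
  dword_re w (fun y => complex.Re (f y)) x +i*
  dword_re w (fun y => complex.Im (f y)) x.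

Definition word_of (a : multi_index) : seq 'I_n :=
  flatten [seq nseq (a i) i | i <- enum 'I_n].

Definition dpartial (a : multi_index) (f : V -> C) : V -> C :=
  dword (word_of a) f.

(* C^infinity on O: all iterated partial derivatives, in any order, exist and
   are continuous at every point of O.  Values of f outside the open set O are
   irrelevant, so a function on O is represented by any extension of it. *)
Definition smooth_on_re (O : set V) (g : V -> R) : Prop :=
  forall (w : seq 'I_n) (x : V), O x ->
    {for x, continuous (dword_re w g)} /\
    forall i : 'I_n, derivable (dword_re w g) x (delta_mx 0 i).

Definition smooth_on (O : set V) : set (V -> C) :=
  [set f | smooth_on_re O (fun x => complex.Re (f x)) /\
           smooth_on_re O (fun x => complex.Im (f x))].

Definition supp (f : V -> C) : set V := closure [set x | f x != 0].

Definition shifted_supp (x : V) (f : V -> C) : set V :=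
  [set x + y | y in supp f].

(* D(O), as a set of functions on the whole space. *)
Definition test (O : set V) : set (V -> C) :=
  [set f | [/\ smooth_on setT f, compact (supp f) & supp f `<=` O]].

Definition absc (z : C) : R := ComplexField.Normc.normc z.

(* Real suprema: [sup] is 0 on the empty set, as wanted here, and also on
   unbounded sets; the latter do not occur where the seminorms below are used
   (K compact and g smooth near K, or g a test function and K the whole
   space). *)
Definition seminorm (K : set V) (m : nat) (g : V -> C) : R :=
  sup [set r | exists x a,
         [/\ K x, (mdeg a <= m)%N & r = absc (dpartial a g x)]].

Definition tnorm (c : nat) (f : V -> C) : R := seminorm setT c f.

Definition bounded_smooth (U : set V) (B : set (V -> C)) : Prop :=
  B `<=` smooth_on U /\
  forall (K : set V) (m : nat), compactly_in K U ->
    exists M : R, forall f, B f -> seminorm K m f <= M.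

(* The seminorm ||phi^star - delta||_{K,c;B}; the derivative of phi(y - x) is
   with respect to x. *)
Definition star_delta_norm (K : set V) (c : nat) (B : set (V -> C))
    (phi : V -> C) : R :=
  sup [set r | exists x a f, [/\ K x, (mdeg a <= c)%N, B f &
    r = absc (integral_rV
                (fun y => f y * dpartial a (fun x' => phi (y - x')) x)
              - dpartial a f x)]].

(* T is D(R^n) for the full algebra and A_0 for the elementary one. *)
Definition pairs (T : set (V -> C)) (O : set V) : set ((V -> C) * V) :=
  [set p | [/\ T p.1, O p.2 & shifted_supp p.2 p.1 `<=` O]].

(* R(phi, .), extended by 0. *)
Definition slice T O (F : pairs T O -> C) (phi : V -> C) : V -> C :=
  fun x => 'valL_(0 : C) F (phi, x).

Definition smooth_slices T O : set (pairs T O -> C) :=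
  [set F | forall phi, T phi ->
     smooth_on [set x | pairs T O (phi, x)] (slice F phi)].

(* Distributions: linear forms on D(O) that are, on test functions supported in
   a given compact set, bounded by a multiple of some ||.||_m. *)
Definition distribution (O : set V) : set (test O -> C) :=
  [set u |
    (forall (k : C) (f g h : test O),
       (forall x, \val h x = k * \val f x + \val g x) -> u h = k * u f + u g) /\
    (forall K : set V, compact K -> K `<=` O ->
       exists (M : R) (m : nat), forall f : test O,
         supp (\val f) `<=` K -> absc (u f) <= M * tnorm m (\val f))].

Definition P0 : set {poly R} := [set p : {poly R} | forall i, 0 <= p`_i].

(* lambda in R^+[y0, z0] with lambda(y0, 0) = 0; the outer variable is z0. *)
Definition I0 : set {poly {poly R}} :=
  [set p : {poly {poly R}} | (forall i j, 0 <= p`_i`_j) /\ p.[0] = 0].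

Definition eval2 (p : {poly {poly R}}) (y z : R) : R := p.[z%:P].[y].

Definition Uc (O : set V) := pairs (test setT) O.

Definition Bc (O : set V) : set (Uc O -> C) := @smooth_slices (test setT) O.

Definition Mc (O : set V) : set (Uc O -> C) :=
  [set F | Bc F /\
    forall x, O x -> exists U : set V, [/\ open U, U x, U `<=` O &
      forall K L : set V,
        compactly_in K U -> compactly_in L U -> compactly_in K L ->
      forall m : nat, exists (c : nat) (p : {poly R}), P0 p /\
      forall phi, test setT phi ->
        [set y + z | y in K & z in supp phi] `<=` L ->
        seminorm K m (slice F phi) <= p.[tnorm c phi]]].

Definition Nc (O : set V) : set (Uc O -> C) :=
  [set F | Bc F /\
    forall x, O x -> exists U : set V, [/\ open U, U x, U `<=` O &
      forall K L : set V,
        compactly_in K U -> compactly_in L U -> compactly_in K L ->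
      forall m : nat, exists (c : nat) (p : {poly {poly R}}) (B : set (V -> C)),
      [/\ I0 p, bounded_smooth U B &
      forall phi, test setT phi ->
        [set y + z | y in K & z in supp phi] `<=` L ->
        seminorm K m (slice F phi) <=
          eval2 p (tnorm c phi) (star_delta_norm K c B phi)]]].

(* A_k *)
Definition moments (k : nat) : set (V -> C) :=
  [set phi | [/\ test setT phi, integral_rV phi = 1 &
    forall a : multi_index, (1 <= mdeg a <= k)%N ->
      integral_rV (fun x => (mono a x)%:C * phi x) = 0]].

Definition scale_test (eps : R) (phi : V -> C) : V -> C :=
  fun x => (eps ^- n)%:C * phi (eps^-1 *: x).

Definition Ue (O : set V) := pairs (moments 0) O.

Definition Ee (O : set V) : set (Ue O -> C) := @smooth_slices (moments 0) O.

Definition EeM (O : set V) : set (Ue O -> C) :=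
  [set F | Ee F /\
    forall K : set V, compactly_in K O -> forall m : nat,
    exists2 N : nat, (0 < N)%N & forall phi, moments N phi ->
      (fun eps : R => seminorm K m (slice F (scale_test eps phi)))
        =O_ (0^'+) (fun eps : R => eps ^- N)].

Definition Ne (O : set V) : set (Ue O -> C) :=
  [set F | Ee F /\
    forall K : set V, compactly_in K O -> forall (m N : nat), (0 < N)%N ->
    exists2 q : nat, (0 < q)%N & forall phi, moments q phi ->
      (fun eps : R => seminorm K m (slice F (scale_test eps phi)))
        =O_ (0^'+) (fun eps : R => eps ^+ N)].

Fact Ue_sub_Uc (O : set V) : Ue O `<=` Uc O.
Proof. by move=> p [[]]. Qed.

Definition restrict_e (O : set V) (F : Uc O -> C) : Ue O -> C :=
  F \o subfun (@Ue_sub_Uc O).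

(* Well-definedness of phi(. - x) as an element of D(O). *)

Lemma dword_re_shift (w : seq 'I_n) (g : V -> R) (x : V) :
  dword_re w (fun y => g (y - x)) = (fun y => dword_re w g (y - x)).
Proof.
elim: w => [//|i w IH]; apply/funext => y.
transitivity ('D_(delta_mx 0 i) (dword_re w (fun y => g (y - x))) y) => //.
rewrite IH; transitivity ('D_(delta_mx 0 i) (dword_re w g) (y - x)) => //.
rewrite /derive (_ : (fun h => _) = (fun h => h^-1 *:
  (((dword_re w g) \o shift (y - x)) (h *: delta_mx 0 i)
   - dword_re w g (y - x)))) //.
by apply/funext => h /=; rewrite addrA.
Qed.

Lemma derivable_shift (g : V -> R) (x y v : V) :
  derivable g (y - x) v -> derivable (fun z => g (z - x)) y v.
Proof.
rewrite /derivable (_ : (fun h => h^-1 *: ((g \o _) _ - _)) =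
  (fun h => h^-1 *: (((fun z => g (z - x)) \o shift y) (h *: v)
   - g (y - x)))) //.
by apply/funext => h /=; rewrite addrA.
Qed.

Lemma addl_continuous (z : V) : continuous (fun y : V => z + y).
Proof.
move=> y; have idy : {for y, continuous (fun x : V => x)} by move=> A.
by apply: continuousD idy; exact: cst_continuous.
Qed.

Lemma smooth_on_re_shift (g : V -> R) (x : V) :
  smooth_on_re setT g -> smooth_on_re setT (fun y => g (y - x)).
Proof.
move=> sg w y _; rewrite dword_re_shift.
have [cg dg] := sg w (y - x) I; split.
- apply: (@continuous_comp _ _ _ (fun z : V => z - x) (dword_re w g)) => //.
  rewrite (_ : (fun z => z - x) = (fun z => - x + z)).
    exact: addl_continuous.
  by apply/funext => z; rewrite addrC.
- by move=> i; exact: derivable_shift.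
Qed.

Lemma supp_shift (f : V -> C) (x : V) :
  supp (fun y => f (y - x)) = shifted_supp x f.
Proof.
have sub (g : V -> C) (z : V) :
    shifted_supp z g `<=` supp (fun y => g (y - z)).
  move=> _ [y gy <-] A /(@addl_continuous z y) /gy [t [/= gt At]].
  by exists (z + t); split => //=; rewrite addrAC subrr add0r.
apply/seteqP; split; last exact: sub.
move=> y fy; exists (y - x); last by rewrite addrC subrK.
have := sub (fun y => f (y - x)) (- x) (y - x).
rewrite (_ : (fun z => f (z - - x - x)) = f); last first.
  by apply/funext => z /=; rewrite opprK addrK.
by apply; exists y => //; rewrite addrC.
Qed.

Lemma test_shift (O : set V) (f : V -> C) (x : V) :
  test setT f -> shifted_supp x f `<=` O -> test O (fun y => f (y - x)).
Proof.
move=> [[sr si] cf _] fO; split; last by rewrite supp_shift.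
- split.
  + exact: (@smooth_on_re_shift (fun y => complex.Re (f y))).
  + exact: (@smooth_on_re_shift (fun y => complex.Im (f y))).
- rewrite supp_shift; apply: continuous_compact => //.
  by apply: continuous_subspaceT; exact: addl_continuous.
Qed.

Fact shift_Uc (O : set V) (p : Uc O) :
  test O (fun y => (\val p).1 (y - (\val p).2)).
Proof. by have [Tp _ pO] := set_valP p; exact: test_shift. Qed.

Fact shift_Ue (O : set V) (p : Ue O) :
  test O (fun y => (\val p).1 (y - (\val p).2)).
Proof. by have [[Tp _ _] _ pO] := set_valP p; exact: test_shift. Qed.

Definition iota_c (O : set V) (u : test O -> C) : Uc O -> C :=
  fun p => u (SigSub (mem_set (shift_Uc p))).

Definition sigma_c (O : set V) (f : V -> C) : Uc O -> C :=
  fun p => f (\val p).2.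

Definition iota_e (O : set V) (u : test O -> C) : Ue O -> C :=
  fun p => u (SigSub (mem_set (shift_Ue p))).

Definition sigma_e (O : set V) (f : V -> C) : Ue O -> C :=
  fun p => f (\val p).2.

End spaces.

Arguments sigma_c {R n} O f _.
Arguments sigma_e {R n} O f _.

(* Main.v *)
Require Import Defs.
From HB Require Import structures.
From mathcomp Require Import measurable_realfun ring lra.
Set Implicit Arguments.
Unset Strict Implicit.
Unset Printing Implicit Defensive.
Import Order.TTheory GRing.Theory Num.Theory.
Local Open Scope classical_set_scope.
Local Open Scope ring_scope.

(** Restricting R to kernels phi of integral 1 does not change the slices
    R(phi, .), so smoothness of slices and the two embeddings are compatible with
    the restriction; what has to be proved about them is that u(phi(. - x)) is
    smooth in x for a distribution u.  For small h the functions phi(. - x - h)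
    have their supports in one compact set, where a single seminorm controls u,
    and Taylor's formula shows that their difference quotients converge in this
    seminorm to minus the derivative of phi(. - x) ([iota_lipschitz],
    [iota_difference]).  Hence every derivative in x falls on phi
    ([dword_re_part_slice]).

    For the asymptotic conditions, the elementary algebra tests with S_e phi.  By
    compactness ([compact_local_to_global]) it is enough to work near a point x0,
    on two concentric balls K and L, and for small e the inclusion of
    K + supp (S_e phi) in L is automatic.  The norm of order c of S_e phi is
    O(e^-(n+c)) ([tnorm_scale]), so a polynomial in it is bounded by a negative
    power of e whose exponent does not depend on phi ([P0_growth]); this is
    moderateness ([Mc_restrict]).

    For negligibility the second argument of lambda has to be small.  After a
    translation, an integration by parts and a scaling, the integral of f against
    a derivative of order a of S_e phi is the integral of the derivative of order
    a of f, at x + e z, against phi(z).  If the moments of phi of order 1, ..., q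
    vanish, all terms of the Taylor polynomial of degree q but the constant one
    integrate to 0, and the remainder is O(e^(q+1)), uniformly for x in K and f
    in a bounded set ([kernel_approx], [star_delta_scale]).  Every monomial of
    lambda contains this small factor ([I0_growth]), and choosing q large makes it
    beat the growth of the norms of S_e phi ([Nc_restrict]).

    The calculus behind this is developed for real functions: affine changes of
    variables for the iterated Lebesgue measure, the vanishing of the integral of
    a partial derivative, Schwarz's theorem and Taylor's formula. *)

(** * Lebesgue measure on R^n *)

Section LebesgueTuple.
Variable R : realType.
Local Notation T := (measurableTypeR R).
Local Notation mu := (@lebesgue_measure R).

Definition tuple_box n (r : R) : set (n.-tuple T) :=
  [set t | forall i, `|tnth t i| <= r].

Lemma measurable_tuple_box n r : measurable (@tuple_box n r).
Proof.
rewrite (_ : tuple_box r = \bigcap_(i in [set: 'I_n])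
    ((fun t : n.-tuple T => tnth t i) @^-1` [set x : T | `|x| <= r])); last first.
  by apply/seteqP; split => [t bt i _|t bt i]; exact: bt.
apply: fin_bigcap_measurable => // i _; rewrite -[X in measurable X]setTI.
apply: measurable_tnth => //.
rewrite (_ : [set x | _] = `[- r, r]%classic) //.
by apply/seteqP; split => x /=; rewrite in_itv /= ler_norml.
Qed.

Lemma lebesgue_tuple_box_fin n r : (lebesgue_tuple R n (tuple_box r) < +oo)%E.
Proof.
elim: n => [|n IH] /=.
  by rewrite diracE; case: (_ \in _); rewrite ltry.
rewrite /pushforward (_ : _ @^-1` _ = tuple_box r `*` `[- r, r]%classic).
  rewrite product_measure1E //; last exact: measurable_tuple_box.
  rewrite lte_mul_pinfty // ?ge0_fin_numE //.
  rewrite -[X in (X < _)%E]/(mu `[- r, r]%classic) lebesgue_measure_itv /=; case: ifP => _;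
    last by rewrite ltry.
  by rewrite -EFinD ltry.
apply/seteqP; split => [[t s] /= bt|[t s] /= [bt bs] i].
  split; last by have := bt ord0; rewrite tnth0 in_itv /= ler_norml.
  by move=> i; have := bt (lift ord0 i); rewrite tnthS.
rewrite in_itv /= -ler_norml in bs.
by case: (unliftP ord0 i) => [j ->|->]; rewrite ?tnthS ?tnth0.
Qed.

(** The set function gets a name of its own because the sigma-finiteness that
    Fubini's theorem asks for is attached to a name. *)
Definition lebesgue_rV n : set (n.-tuple T) -> \bar R := lebesgue_tuple R n.

HB.instance Definition _ n := Measure.on (@lebesgue_rV n).

Lemma lebesgue_rV_sigma_finite n : sigma_finite setT (@lebesgue_rV n).
Proof.
exists (fun k => @tuple_box n k%:R); last first.
  by move=> k; split; [exact: measurable_tuple_box|exact: lebesgue_tuple_box_fin].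
apply/esym; rewrite -subTset => t _.
pose M := \sum_(i < n) `|tnth t i|.
exists (Num.truncn M).+1 => // i.
have : `|tnth t i| <= M.
  by rewrite /M (bigD1 i) //= lerDl sumr_ge0.
by move/le_trans; apply; rewrite ltW // truncnS_gt.
Qed.

HB.instance Definition _ n :=
  Measure_isSigmaFinite.Build _ _ _ (@lebesgue_rV n) (@lebesgue_rV_sigma_finite n).

(** The two sides are the integrals of f for two measures that agree on
    half-open intervals. *)
Lemma ge0_integral_lebesgue_affine (e a : R) (f : R -> \bar R) : 0 < e ->
  measurable_fun [set: R] f -> (forall x, 0 <= f x)%E ->
  (e%:E * \int[mu]_x f (e * x + a)%R = \int[mu]_x f x)%E.
Proof.
move=> e0 mf f0.
pose phi := (fun x : T => e * x + a : T).
have mphi : measurable_fun setT phi.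
  apply: measurable_funD => //; exact: measurable_funM.
have e0' : 0 <= e by exact: ltW.
pose m := mscale (NngNum e0')
  (measure_function_pushforward__canonical__measure_function_Measure mu mphi).
transitivity (\int[m]_x f x)%E; last first.
  apply: eq_measure_integral => A mA _; apply/esym.
  apply: lebesgue_measure_unique => // _ [[x y] /= _ <-].
  rewrite /m /mscale /= /pushforward.
  rewrite (_ : _ @^-1` _ = `](x - a) / e, (y - a) / e]%classic).
    rewrite !lebesgue_measure_itv /= !lte_fin ltr_pM2r ?invr_gt0 // ltrD2r.
    case: ifP => _; last by rewrite mule0.
    by rewrite -!EFinD -EFinM -mulrBl mulrC divfK ?gt_eqF // opprB addrA subrK.
  apply/seteqP; split => z /=; rewrite !in_itv /= ltr_pdivrMr // ler_pdivlMr //;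
  by rewrite ltrBlDr lerBrDr /phi mulrC.
rewrite ge0_integral_mscale //= -/(pushforward mu phi).
congr (_ * _)%E; rewrite ge0_integral_pushforward //.
Qed.

Lemma ge0_integral_tupleS n (f : n.+1.-tuple T -> \bar R) :
  measurable_fun setT f -> (forall t, 0 <= f t)%E ->
  (\int[lebesgue_tuple R n.+1]_t f t =
   \int[@lebesgue_rV n]_t \int[mu]_s f [tuple of s :: t])%E.
Proof.
move=> mf f0; rewrite /=.
rewrite (ge0_integral_pushforward (@measurable_tuple_cons R n)) //.
rewrite -[LHS]/(\int[@lebesgue_rV n \x mu]_p (f \o @tuple_cons R n) p)%E.
rewrite fubini_tonelli1 //; last by move=> p; exact: f0.
by apply: measurableT_comp => //; exact: measurable_tuple_cons.
Qed.

Definition affine_tuple n (e : R) (a t : n.-tuple T) : n.-tuple T :=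
  [tuple e * tnth t i + tnth a i | i < n].

Lemma measurable_affine_tuple n e a : measurable_fun setT (@affine_tuple n e a).
Proof.
apply/measurable_fun_tnthP => i.
rewrite (_ : _ \o _ = fun t => e * tnth t i + tnth a i).
  apply: measurable_funD => //; apply: measurable_funM => //.
  exact: measurable_tnth.
by apply/funext => t /=; rewrite tnth_mktuple.
Qed.

(** Tonelli's theorem reduces the change of variables to the one-dimensional
    one, coordinate by coordinate. *)
Lemma ge0_integral_tuple_affine n (e : R) (a : n.-tuple T)
    (f : n.-tuple T -> \bar R) : 0 < e ->
  measurable_fun setT f -> (forall t, 0 <= f t)%E ->
  ((e ^+ n)%:E * \int[lebesgue_tuple R n]_t f (affine_tuple e a t) =
   \int[lebesgue_tuple R n]_t f t)%E.
Proof.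
move=> e0; elim: n => [|n IH] in a f *; move=> mf f0.
  rewrite expr0 mul1e; apply: eq_integral => t _; congr f.
  by rewrite tuple0 [RHS]tuple0.
rewrite !ge0_integral_tupleS //; last first.
  by apply: measurableT_comp => //; exact: measurable_affine_tuple.
pose g (t : n.-tuple T) : \bar R := (\int[mu]_s f [tuple of s :: t])%E.
have mcons : measurable_fun setT (fun p : n.-tuple T * T => f (tuple_cons p)).
  by apply: measurableT_comp => //; exact: measurable_tuple_cons.
have mg : measurable_fun setT g.
  exact: (@measurable_fun_fubini_tonelli_F _ _ _ _ _ mu
    (fun p : n.-tuple T * T => f (tuple_cons p))).
have g0 t : (0 <= g t)%E by apply: integral_ge0.
rewrite -[RHS](IH [tuple of behead a] g mg g0) exprSr EFinM -muleA.
congr (_ * _)%E.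
rewrite -ge0_integralZl //; last 3 first.
- apply: (@measurable_fun_fubini_tonelli_F _ _ _ _ _ mu
    (fun p : n.-tuple T * T => f (affine_tuple e a (tuple_cons p)))) => //.
  apply: measurableT_comp => //; apply: measurableT_comp => //.
    exact: measurable_affine_tuple.
  exact: measurable_tuple_cons.
- by move=> t _; apply: integral_ge0.
- by rewrite lee_fin ltW.
apply: eq_integral => t _; rewrite /g.
rewrite -[RHS](@ge0_integral_lebesgue_affine e (tnth a ord0)) //.
  congr (_ * _)%E; apply: eq_integral => s _; congr f.
  apply: eq_from_tnth => i; rewrite tnth_mktuple.
  case: (unliftP ord0 i) => [j ->|->]; rewrite ?tnthS ?tnth0 //.
  rewrite tnth_mktuple; congr (_ + _).
  by rewrite [in LHS](tuple_eta a) tnthS.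
apply: measurableT_comp => //; apply: measurable_cons => //.
Qed.


Section IntegralV.
Variable n : nat.
Local Notation V := 'rV[R]_n.

Definition row_of_tuple (t : n.-tuple T) : V := \row_j tnth t j.

Definition intV (g : V -> R) : R :=
  (\int[lebesgue_tuple R n]_t g (row_of_tuple t))%R.

Lemma integral_rVE (f : V -> R[i]) : integral_rV f =
  Complex (intV (fun x => complex.Re (f x))) (intV (fun x => complex.Im (f x))).
Proof. by []. Qed.

Lemma row_coord_le (x : V) i : `|x 0 i| <= `|x|.
Proof.
rewrite [leRHS]/Num.norm /= mx_normrE; apply/bigmax_geP; right => /=.
by exists (0, i).
Qed.

Lemma row_norm_le (x : V) (r : R) :
  0 <= r -> (forall i, `|x 0 i| <= r) -> `|x| <= r.
Proof.
move=> r0 xr; rewrite [leLHS]/Num.norm /= mx_normrE; apply/bigmax_leP.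
by split => // -[i j] _ /=; rewrite (ord1 i).
Qed.

(** The product sigma-algebra contains the half-open boxes of the grids of mesh
    1/(k+1), so the functions that are constant on the boxes of such a grid are
    measurable; g is the limit of the functions taking on each box the value of
    g at its lower corner. *)
Lemma continuous_measurable_tuple (g : V -> R) : continuous g ->
  measurable_fun [set: n.-tuple T] (g \o row_of_tuple).
Proof.
move=> cg.
pose grid (k : nat) (z : 'rV[int]_n) : V := \row_j ((z 0 j)%:~R / k.+1%:R).
pose d (k : nat) (t : n.-tuple T) : 'rV[int]_n :=
  \row_j Num.floor (k.+1%:R * tnth t j).
have md k (z : 'rV[int]_n) : measurable [set t | d k t = z].
  rewrite (_ : [set t | _] = \bigcap_(j in [set: 'I_n])
    ((fun t : n.-tuple T => tnth t j) @^-1`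
      [set x : T | (z 0 j)%:~R / k.+1%:R <= x < (z 0 j + 1)%:~R / k.+1%:R])).
    apply: fin_bigcap_measurable => // j _; rewrite -[X in measurable X]setTI.
    apply: measurable_tnth => //.
    rewrite (_ : [set x | _] =
      `[(z 0 j)%:~R / k.+1%:R, (z 0 j + 1)%:~R / k.+1%:R[%classic) //.
  apply/seteqP; split => [t /= dt j _ /=|t /= zt].
    rewrite ler_pdivrMr // ltr_pdivlMr // mulrC -dt mxE; exact: floor_itv.
  apply/rowP => j; rewrite mxE; apply/floor_def.
  by have := zt j I; rewrite /= ler_pdivrMr // ltr_pdivlMr // mulrC.
apply: (@measurable_fun_cvg _ _ _ _ (fun k t => g (grid k (d k t)))).
  move=> k _ Y mY; rewrite setTI.
  rewrite (_ : _ @^-1` Y = \bigcup_(z : 'rV[int]_n)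
      ([set t | d k t = z] `&` [set t | Y (g (grid k z))])).
    apply: countable_bigcupT_measurable; first exact: countableP.
    move=> z; apply: measurableI; first exact: md.
    by case: (pselect (Y (g (grid k z)))) => Yg;
      [rewrite (_ : [set _ | _] = setT)|rewrite (_ : [set _ | _] = set0)] => //;
      apply/seteqP; split.
  apply/seteqP; split => [t /= Yt|t [z _ [/= -> Yz]]] //.
  by exists (d k t).
move=> t _ /=; apply: continuous_cvg; first exact: cg.
apply/cvgrPdist_le => /= e e0; near=> k.
apply: row_norm_le; first exact: ltW.
move=> i; rewrite !mxE.
have k0 : (0 : R) < k.+1%:R by [].
have /andP[fl fu] := floor_itv (k.+1%:R * tnth t i).
rewrite -(ler_pM2l k0) -[X in X * _]gtr0_norm // -normrM mulrBr.
rewrite [X in _ - X]mulrC divfK ?gt_eqF //.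
rewrite ger0_norm ?subr_ge0 //.
have k1 : 1 <= k.+1%:R * e.
  rewrite -ler_pdivrMr // div1r; near: k; exists (Num.truncn e^-1) => // k /= ke.
  by rewrite (le_trans (ltW (truncnS_gt _))) // ler_nat ltnS.
by rewrite (le_trans _ k1) // lerBlDl -[leRHS]/(_%:~R + 1%:~R) -intrD ltW.
Unshelve. all: by end_near.
Qed.


Lemma continuous_affine (e : R) (a : V) : continuous (fun x : V => e *: x + a).
Proof.
move=> x; apply: (@continuousD _ _ _ (fun x : V => e *: x) (fun=> a)).
  exact: scaler_continuous.
exact: cst_continuous.
Qed.

Lemma continuous_comp_affine (g : V -> R) (e : R) (a : V) :
  continuous g -> continuous (fun x : V => g (e *: x + a)).
Proof.
move=> cg x; have ca := @continuous_affine e a x.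
exact: (continuous_comp ca (cg _)).
Qed.

Lemma measurable_intV (g : V -> R) : continuous g ->
  measurable_fun [set: n.-tuple T] (fun t => (g (row_of_tuple t))%:E).
Proof. by move=> cg; apply/measurable_EFinP; exact: continuous_measurable_tuple. Qed.

Definition box_vol (r : R) : R := fine (lebesgue_tuple R n (@tuple_box n r)).

Lemma box_vol_ge0 r : 0 <= box_vol r.
Proof. by rewrite /box_vol fine_ge0. Qed.

Definition vanishes_outside (r : R) (g : V -> R) := forall x, r < `|x| -> g x = 0.

Lemma vanishes_outside_indic r (g : V -> R) (M : R) (t : n.-tuple T) :
  vanishes_outside r g -> (forall x, `|g x| <= M) ->
  `|g (row_of_tuple t)| <= M * \1_(@tuple_box n r) t.
Proof.
move=> gr gM; rewrite indicE; case: (boolP (t \in _)) => tr.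
  by rewrite mulr1.
rewrite mulr0 gr ?normr0 //.
have [i ti] : exists i, ~ (`|tnth t i| <= r).
  by apply/existsNP => h; move/negP: tr; apply; rewrite inE.
move/negP: ti; rewrite -ltNge => ti; apply: lt_le_trans ti _.
by have := row_coord_le (row_of_tuple t) i; rewrite mxE.
Qed.

Lemma integrable_box r (M : R) : (lebesgue_tuple R n).-integrable setT
  (fun t => (M * \1_(@tuple_box n r) t)%:E).
Proof.
apply/integrableP; split.
  apply/measurable_EFinP; apply: measurable_funM => //.
  by apply: measurable_indic; exact: measurable_tuple_box.
rewrite (eq_integral (fun t => `|M|%:E * (\1_(@tuple_box n r) t)%:E)%E); last first.
  by move=> t _; rewrite /= -EFinM normrM [X in _ * X]ger0_norm.
rewrite ge0_integralZl //; last first.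
  by apply/measurable_EFinP; apply: measurable_indic; exact: measurable_tuple_box.
rewrite integral_indic ?setIT //; last exact: measurable_tuple_box.
rewrite lte_mul_pinfty // ?ge0_fin_numE //.
exact: lebesgue_tuple_box_fin.
Qed.

Lemma integrable_intV r (g : V -> R) (M : R) : continuous g -> vanishes_outside r g ->
  (forall x, `|g x| <= M) ->
  (lebesgue_tuple R n).-integrable setT (fun t => (g (row_of_tuple t))%:E).
Proof.
move=> cg gr gM.
apply: le_integrable (integrable_box r M) => //; first exact: measurable_intV.
move=> t _ /=; rewrite lee_fin (le_trans (vanishes_outside_indic t gr gM)) //.
exact: ler_norm.
Qed.

Lemma intV_le r (g : V -> R) (M : R) : continuous g -> vanishes_outside r g ->
  (forall x, `|g x| <= M) -> `|intV g| <= M * box_vol r.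
Proof.
move=> cg gr gM; have ig := integrable_intV cg gr gM.
apply: (le_trans (le_normr_Rintegral _ ig)) => //.
apply: (@le_trans _ _ (\int[lebesgue_tuple R n]_t (M * \1_(@tuple_box n r) t))%R).
  apply: le_Rintegral => //.
  - exact: integrable_norm.
  - exact: integrable_box.
  - by move=> t _; exact: vanishes_outside_indic.
rewrite RintegralZl //.
  rewrite /Rintegral integral_indic ?setIT //; exact: measurable_tuple_box.
by have := integrable_box r 1; under eq_fun do rewrite mul1r.
Qed.

Lemma intVD r (f g : V -> R) (M : R) : continuous f -> continuous g ->
  vanishes_outside r f -> vanishes_outside r g -> (forall x, `|f x| <= M) ->
  (forall x, `|g x| <= M) -> intV (fun x => f x + g x) = intV f + intV g.
Proof.
move=> cf cg fr gr fM gM.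
apply: (RintegralD _ (integrable_intV cf fr fM) (integrable_intV cg gr gM)) => //.
Qed.

Lemma intVZ r (k : R) (f : V -> R) (M : R) : continuous f ->
  vanishes_outside r f -> (forall x, `|f x| <= M) ->
  intV (fun x => k * f x) = k * intV f.
Proof.
by move=> cf fr fM; apply: (RintegralZl _ _ (integrable_intV cf fr fM)).
Qed.

(** The formula holds for the positive and the negative part of g, and both have
    finite integrals. *)
Lemma intV_affine r (M : R) (g : V -> R) (e : R) (a : V) : 0 < e ->
  continuous g -> vanishes_outside r g -> (forall x, `|g x| <= M) ->
  e ^+ n * intV (fun x => g (e *: x + a)) = intV g.
Proof.
move=> e0 cg gr gM; pose at_ := [tuple a 0 i | i < n] : n.-tuple T.
have E t : e *: row_of_tuple t + a = row_of_tuple (affine_tuple e at_ t).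
  by apply/rowP => i; rewrite !mxE !tnth_mktuple.
have mg := measurable_intV cg.
have cge : continuous (fun x : V => g (e *: x + a)).
  exact: continuous_comp_affine.
have ger : vanishes_outside ((r + `|a|) / e) (fun x : V => g (e *: x + a)).
  move=> x; rewrite ltr_pdivrMr // => xr; apply: gr.
  rewrite -(ltrD2r `|a|) (lt_le_trans xr) // -[X in _ * X]gtr0_norm //.
  by rewrite mulrC -normrZ -[X in `|X|](addrK a) ler_normB.
have ig := integrable_intV cg gr gM.
have ige := integrable_intV cge ger (fun x => gM (e *: x + a)).
rewrite /intV /Rintegral -[X in X * _]/(fine (e ^+ n)%:E) -fineM //; last first.
  exact: integrable_fin_num.
congr fine; rewrite [in RHS]integralE [in LHS]integralE muleBr //; last first.
  by rewrite fin_num_adde_defl // fin_numN; exact: integrable_neg_fin_num.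
rewrite -(@ge0_integral_tuple_affine n e at_ _ e0 (measurable_funepos mg)) //.
rewrite -(@ge0_integral_tuple_affine n e at_ _ e0 (measurable_funeneg mg)) //.
by congr (_ * _ - _ * _)%E; apply: eq_integral => t _; rewrite !(funeposE, funenegE) E.
Qed.

Lemma intV_cvg r (M : R) (f : (V -> R)^nat) (g : V -> R) :
  (forall k, continuous (f k)) -> continuous g -> (forall k, vanishes_outside r (f k)) ->
  (forall k x, `|f k x| <= M) -> (forall x, f ^~ x @ \oo --> g x) ->
  (fun k => intV (f k)) @ \oo --> intV g.
Proof.
move=> cf cg fr fM fg.
have [|||||ig _] := @dominated_convergence _ _ _ (lebesgue_tuple R n) setT
  measurableT (fun k t => (f k (row_of_tuple t))%:E)
  (fun t => (g (row_of_tuple t))%:E)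
  (fun t => (M * \1_(@tuple_box n r) t)%:E).
- by move=> k; exact: measurable_intV.
- exact: measurable_intV.
- by apply/aeW => t _; apply/cvg_EFin; [apply: nearW|exact: fg].
- exact: integrable_box.
- by apply/aeW => t k _; rewrite lee_fin; exact: vanishes_outside_indic.
- move=> cv; rewrite /intV /Rintegral; apply: fine_cvg.
  by rewrite fineK; [exact: cv|exact: integrable_fin_num].
Qed.

End IntegralV.
End LebesgueTuple.

(** * Directional derivatives and Schwarz's theorem *)

Section Lines.
Variables (R : realType) (n : nat).
Local Notation V := 'rV[R]_n.

(** Restricting to a line gives access to the one-dimensional chain rule and
    mean value theorem. *)
Lemma derivable_lineP (g : V -> R) (x v : V) (s : R) :
  derivable g (x + s *: v) v ->
  is_derive s (1 : R) (fun s : R => g (x + s *: v)) ('D_v g (x + s *: v)).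
Proof.
move=> dg.
have E : (fun h : R => h^-1 *: ((((fun s : R => g (x + s *: v)) \o shift s) (h *: 1))
   - g (x + s *: v))) =
  (fun h => h^-1 *: ((g \o shift (x + s *: v)) (h *: v) - g (x + s *: v))).
  apply/funext => h /=; congr (_ *: (g _ - _)).
  by rewrite -[h *: 1]/(h * 1) mulr1 scalerDl addrCA.
by apply: DeriveDef; rewrite /derivable /derive E.
Qed.

Lemma is_derive_line (g : V -> R) (x v : V) (d : R) :
  is_derive (0 : R) (1 : R) (fun s : R => g (x + s *: v)) d -> is_derive x v g d.
Proof.
have E : (fun h : R => h^-1 *: ((((fun s : R => g (x + s *: v)) \o shift 0) (h *: 1))
   - g (x + 0 *: v))) =
  (fun h => h^-1 *: ((g \o shift x) (h *: v) - g x)).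
  apply/funext => h /=.
  rewrite (_ : x + 0 *: v = x) ?scale0r ?addr0 //; congr (_ *: (g _ - _)).
  by rewrite -[h *: 1]/(h * 1) mulr1 addrC.
by case; rewrite /derivable /derive E => ? ?; apply: DeriveDef.
Qed.

Lemma is_derive_scale1 (G : R -> R) (c s d : R) :
  is_derive (c * s) (1 : R) G d -> is_derive s (1 : R) (fun s => G (c * s)) (c * d).
Proof.
move=> [dG <-].
have dc : is_derive s (1 : R) (fun s : R => c * s) c.
  have di : derivable (@id R) s 1 by exact: derivable_id.
  have := is_deriveZ c (derivableP di); rewrite derive_val.
  by rewrite [_ *: _]mulr1.
have [dc1 dc2] := dc; apply: DeriveDef.
  apply/derivable1_diffP; apply: (differentiable_comp (g := G)).
    exact: (derivable1_diffP _ _).1 dc1.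
  exact: (derivable1_diffP _ _).1 dG.
have := derive1_comp dc1 dG; rewrite !derive1E dc2 mulrC => <-; by [].
Qed.

Lemma is_derive_affine (g : V -> R) (l : R) (b x v : V) :
  derivable g (l *: x + b) v ->
  is_derive x v (fun x => g (l *: x + b)) (l * 'D_v g (l *: x + b)).
Proof.
move=> dg; apply: is_derive_line.
have dg0 : derivable g (l *: x + b + 0 *: v) v by rewrite scale0r addr0.
have dL := derivable_lineP dg0.
have E : (fun s : R => g (l *: (x + s *: v) + b)) =
    (fun s : R => g (l *: x + b + s *: v)) \o (fun s : R => l * s).
  by apply/funext => s /=; rewrite scalerDr scalerA addrAC.
rewrite scale0r addr0 in dL.
by rewrite E; apply: is_derive_scale1; rewrite mulr0.
Qed.

Lemma is_derive_scaledir (g : V -> R) (x v : V) (c : R) :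
  derivable g x v -> is_derive x (c *: v) g (c * 'D_v g x).
Proof.
move=> dg; apply: is_derive_line.
have dg0 : derivable g (x + 0 *: v) v by rewrite scale0r addr0.
have dL := derivable_lineP dg0.
have E : (fun s : R => g (x + s *: (c *: v))) =
    (fun s : R => g (x + s *: v)) \o (fun s : R => c * s).
  by apply/funext => s /=; rewrite scalerA mulrC.
rewrite scale0r addr0 in dL.
by rewrite E; apply: is_derive_scale1; rewrite mulr0.
Qed.

Lemma MVT01 (f df : R -> R) :
  (forall s : R, 0 <= s <= 1 -> is_derive s (1 : R) f (df s)) ->
  exists2 s : R, 0 <= s <= 1 & f 1 - f 0 = df s.
Proof.
move=> fd; have [|||s s01 E] := @MVT_segment _ f df 0 1.
- by [].
- by move=> s; rewrite in_itv /= => /andP[/ltW ? /ltW ?]; apply: fd; apply/andP.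
- apply: derivable_within_continuous => s; rewrite in_itv /= => s01.
  by have := fd s s01; case.
by exists s; [move: s01; rewrite in_itv|rewrite E subr0 mulr1].
Qed.

Lemma line_MVT (g : V -> R) (x v : V) (t : R) :
  (forall s : R, 0 <= s <= 1 -> derivable g (x + (s * t) *: v) v) ->
  exists2 s : R, 0 <= s <= 1 & g (x + t *: v) - g x = t * 'D_v g (x + (s * t) *: v).
Proof.
move=> dg; pose f (s : R) := g (x + s *: (t *: v)).
have [s /dg ds|s s01] := @MVT01 f (fun s => t * 'D_v g (x + (s * t) *: v)).
  have [|ds' E] := derivable_lineP (g := g) (x := x) (v := t *: v) (s := s).
    by rewrite scalerA; have [] := is_derive_scaledir t ds.
  apply: DeriveDef => //; rewrite E scalerA.
  by have [_ ->] := is_derive_scaledir t ds.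
by rewrite /f scale0r addr0 scale1r => E; exists s.
Qed.

Lemma near_norm (x : V) (P : V -> Prop) : (\forall y \near x, P y) ->
  exists2 r : R, 0 < r & forall y, `|y - x| < r -> P y.
Proof.
move=> /nbhs_ballP[r /= r0 rP]; exists r => // y yx; apply: rP.
by rewrite -ball_normE /ball_ /= distrC.
Qed.

Lemma near_mul_lt (c r : R) : 0 < r -> \forall h \near (0 : R)^', `|h| * c < r.
Proof.
move=> r0; have [c0|c0] := leP c 0; near=> h.
  by apply: le_lt_trans r0; rewrite mulr_ge0_le0.
rewrite -ltr_pdivlMr //; near: h.
by apply: dnbhs0_lt; rewrite divr_gt0.
Unshelve. all: by end_near.
Qed.

(** One goes from x along u first and then along v; by the mean value theorem the
    second increment is a derivative in the direction v at a nearby point. *)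
Lemma is_derive_adddir (g : V -> R) (x u v : V) :
  derivable g x u -> (\forall y \near x, derivable g y v) ->
  {for x, continuous ('D_v g)} ->
  is_derive x (u + v) g ('D_u g x + 'D_v g x).
Proof.
move=> du dv cv.
suff H : (h^-1 *: ((g \o shift x) (h *: (u + v)) - g x)) @[h --> 0^'] -->
    'D_u g x + 'D_v g x.
  apply: DeriveDef; first by apply/cvg_ex; eexists; exact: H.
  exact: cvg_lim H.
pose A (h : R) := h^-1 *: (g (h *: (u + v) + x) - g (h *: u + x)).
have E : (fun h : R => h^-1 *: ((g \o shift x) (h *: (u + v)) - g x)) =
   (fun h => h^-1 *: ((g \o shift x) (h *: u) - g x)) \+ A.
  by apply/funext => h /=; rewrite /A -scalerDr [X in _ = _ *: X]addrC addrA subrK.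
rewrite E; apply: cvgD; first exact: du.
apply/cvgrPdist_le => /= e e0.
have [r r0 rP] : exists2 r : R, 0 < r & forall y, `|y - x| < r ->
    derivable g y v /\ `|'D_v g x - 'D_v g y| <= e.
  apply: near_norm; move/cvgrPdist_le : cv => /(_ _ e0) cv.
  by apply: filterS2 dv cv => y dy y1; split; [exact: dy|].
near=> h; have h0 : h != 0 by near: h; exact: nbhs_dnbhs_neq.
have hr : `|h| * (`|u| + `|v|) < r.
  near: h; exact: near_mul_lt.
have hs (s : R) : 0 <= s <= 1 -> `|h *: u + x + (s * h) *: v - x| < r.
  move=> /andP[s0 s1]; apply: le_lt_trans hr.
  rewrite addrAC addrK mulrDr (le_trans (ler_normD _ _)) // !normrZ lerD2l.
  by rewrite -mulrA ler_piMl ?mulr_ge0 // ger0_norm.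
have [s /hs/rP[//]|s /hs/rP[_ se] E'] := @line_MVT g (h *: u + x) v h.
rewrite /A [h *: (u + v)]scalerDr addrAC E'.
by rewrite -[_ *: _]/(_ * _) mulKf.
Unshelve. all: by end_near.
Qed.


(** The mean value theorem is applied to y |-> g (y + t f) - g y along e, and then
    to the derivative of g in the direction e along f. *)
Lemma second_difference (g : V -> R) (x e f : V) (r t : R) :
  (forall y, `|y - x| < r -> derivable g y e /\ derivable ('D_e g) y f) ->
  0 < t -> t * (`|e| + `|f|) < r ->
  exists2 p, `|p - x| < r &
    g (x + t *: e + t *: f) - g (x + t *: e) - (g (x + t *: f) - g x)
      = t * (t * 'D_f ('D_e g) p).
Proof.
move=> gr t0 tr.
have hs (s s' : R) : 0 <= s <= 1 -> 0 <= s' <= 1 ->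
    `|x + (s * t) *: e + (s' * t) *: f - x| < r.
  move=> /andP[s0 s1] /andP[s0' s1']; apply: le_lt_trans tr.
  rewrite [x + _]addrC addrAC addrK mulrDr.
  rewrite (le_trans (ler_normD _ _)) // !normrZ ?normrM.
  by rewrite (gtr0_norm t0) (ger0_norm s0) (ger0_norm s0') lerD //
    ler_wpM2r // ler_piMl // ltW.
have i0 : 0 <= (0 : R) <= 1 by apply/andP; split.
have i1 : 0 <= (1 : R) <= 1 by apply/andP; split.
pose A y := g (y + t *: f) - g y.
have dA (s : R) : 0 <= s <= 1 -> is_derive (x + (s * t) *: e) e A
    ('D_e g (x + (s * t) *: e + t *: f) - 'D_e g (x + (s * t) *: e)).
  move=> s01; apply: is_deriveB; last first.
    apply: derivableP; have := hs _ _ s01 i0.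
    by rewrite mul0r scale0r addr0 => /gr[].
  have := @is_derive_affine g 1 (t *: f) (x + (s * t) *: e) e.
  rewrite scale1r mul1r; under [X in is_derive _ _ X]funext do rewrite scale1r.
  apply; have := hs _ _ s01 i1; rewrite mul1r => /gr[dgy _]; exact: dgy.
have [s /dA[//]|s s01] := @line_MVT A x e t.
have [_ ->] := dA _ s01; rewrite /A => E; have [s' s01'|s' s01'] :=
  @line_MVT ('D_e g) (x + (s * t) *: e) f t.
  by have /gr[] := hs _ _ s01 s01'.
move=> E'.
exists (x + (s * t) *: e + (s' * t) *: f); first exact: hs.
by rewrite -E' -E.
Qed.

Lemma dist_half_le (a a' b b' eps : R) : `|a - a'| <= eps / 2 ->
  `|b - b'| <= eps / 2 -> a' = b' -> `|a - b| <= eps.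
Proof.
move=> aa bb ab; rewrite (_ : a - b = (a - a') - (b - b')); last by rewrite ab; ring.
by rewrite (le_trans (ler_normB _ _)) // (splitr eps) lerD.
Qed.

(** Schwarz's theorem: the second difference is symmetric in the two
    directions, and is close to either mixed derivative. *)
Lemma derive_swap (g : V -> R) (x e f : V) :
  (\forall y \near x, [/\ derivable g y e, derivable g y f,
     derivable ('D_e g) y f & derivable ('D_f g) y e]) ->
  {for x, continuous ('D_f ('D_e g))} -> {for x, continuous ('D_e ('D_f g))} ->
  'D_f ('D_e g) x = 'D_e ('D_f g) x.
Proof.
move=> dg c1 c2; apply/eqP; rewrite -subr_eq0 -normr_le0; apply/ler_addgt0Pl => eps e0.
rewrite addr0.
have e2 : 0 < eps / 2 by rewrite divr_gt0.
move/cvgrPdist_le : c1 => /(_ _ e2) c1.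
move/cvgrPdist_le : c2 => /(_ _ e2) c2.
have [r r0 rP] := near_norm (filterI dg (filterI c1 c2)).
(* The summand 1 covers the case e = f = 0. *)
pose c := `|e| + `|f| + 1; pose t := r / (2 * c).
have c0 : 0 < c by rewrite ltr_wpDl.
have t0 : 0 < t by rewrite divr_gt0 // mulr_gt0.
have tr : t * (`|e| + `|f|) < r.
  apply: (@lt_le_trans _ _ (t * c)); first by rewrite ltr_pM2l // ltrDl.
  rewrite /t invfM mulrA divfK ?gt_eqF //.
  by rewrite ler_pdivrMr // ler_peMr ?ler1n // ltW.
have [y /rP[[]]//|p /rP[_ [p1 _]] E1] := second_difference _ t0 tr (x := x) (g := g).
have [y /rP[[]]//||q /rP[_ [_ q1]] E2] :=
  @second_difference g x f e r t _ t0 _; first by rewrite addrC.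
have pq : 'D_f ('D_e g) p = 'D_e ('D_f g) q.
  have tn0 : t != 0 by rewrite gt_eqF.
  apply: (mulfI tn0); apply: (mulfI tn0).
  have swap (a1 a2 a3 a4 : R) : a1 - a2 - (a3 - a4) = a1 - a3 - (a2 - a4) by ring.
  apply: (etrans (esym E1)); apply: (etrans _ E2).
  have -> : x + t *: f + t *: e = x + t *: e + t *: f by rewrite addrAC.
  exact: swap.
exact: dist_half_le p1 q1 pq.
Qed.

End Lines.

(** * Iterated partial derivatives *)

Section Words.
Variables (R : realType) (n : nat).
Local Notation V := 'rV[R]_n.
Implicit Types (g : V -> R) (O : set V) (w : seq 'I_n).
Local Notation d_ i := (delta_mx 0 i : V).

Lemma near_open O (P : V -> Prop) x : open O -> O x -> (forall y, O y -> P y) ->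
  \forall y \near x, P y.
Proof. by move=> oO Ox OP; exact: filterS OP (open_nbhs_nbhs _). Qed.

Lemma dword_re_cat w1 w2 g : dword_re (w1 ++ w2) g = dword_re w1 (dword_re w2 g).
Proof. by rewrite /dword_re foldr_cat. Qed.

Lemma smooth_dword O g w : smooth_on_re O g -> smooth_on_re O (dword_re w g).
Proof. by move=> sg w' x Ox; rewrite -dword_re_cat; exact: sg. Qed.

Lemma smooth_derivable O g x i : smooth_on_re O g -> O x -> derivable g x (d_ i).
Proof. by move=> sg Ox; have [_] := sg [::] x Ox. Qed.

Lemma smooth_continuous O g x : smooth_on_re O g -> O x -> {for x, continuous g}.
Proof. by move=> sg Ox; have [] := sg [::] x Ox. Qed.

Lemma smooth_subset O O' g : O' `<=` O -> smooth_on_re O g -> smooth_on_re O' g.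
Proof. by move=> OO' sg w x /OO'; exact: sg. Qed.

Lemma dword_re_local O f g w : open O -> (forall x, O x -> f x = g x) ->
  forall x, O x -> dword_re w f x = dword_re w g x.
Proof.
move=> oO fg; elim: w => [//|i w IH] x Ox /=.
exact/near_eq_derive/(near_open oO Ox).
Qed.

Lemma continuous_near_eq f g x : (\forall y \near x, f y = g y) ->
  {for x, continuous f} -> {for x, continuous g}.
Proof.
move=> fg; rewrite /prop_for /continuous_at -(nbhs_singleton fg) => cf.
exact: cvg_trans (near_eq_cvg fg) cf.
Qed.

Lemma smooth_local O f g : open O -> (forall x, O x -> f x = g x) ->
  smooth_on_re O f -> smooth_on_re O g.
Proof.
move=> oO fg sf w x Ox; have [c d] := sf w x Ox.
have nfg : \forall y \near x, dword_re w f y = dword_re w g y.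
  by apply: (near_open oO Ox); exact: dword_re_local.
split; first exact: continuous_near_eq nfg c.
by move=> i; exact: near_eq_derivable nfg (d i).
Qed.

(** The vector h is built up coordinate by coordinate; continuity of the partial
    derivatives makes each step additive. *)
Lemma smooth_is_derive O g x h : open O -> O x -> smooth_on_re O g ->
  is_derive x h g (\sum_(i < n) h 0 i * dword_re [:: i] g x).
Proof.
move=> oO Ox sg; rewrite [h in is_derive _ h]row_sum_delta.
elim/big_rec2: _ => [|i d v _ IH]; first exact: is_derive0.
have di y : O y -> is_derive y (h 0 i *: d_ i) g (h 0 i * dword_re [:: i] g y).
  by move=> Oy; apply: is_derive_scaledir; exact: smooth_derivable Oy.
rewrite addrC [X in is_derive _ _ _ X]addrC.
have [dv <-] := IH; have [_ <-] := di x Ox; apply: is_derive_adddir; first exact: dv.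
  by apply: (near_open oO Ox) => y /di[].
have c : {for x, continuous (fun y => h 0 i * dword_re [:: i] g y)}.
  by apply: continuousM; [exact: cst_continuous|exact: (sg [:: i] x Ox).1].
have nE : \forall y \near x, h 0 i * dword_re [:: i] g y = 'D_(h 0 i *: d_ i) g y.
  by apply: (near_open oO Ox) => y /di[].
exact: continuous_near_eq nE c.
Qed.

Lemma dword_re_swap O g i j w x : open O -> smooth_on_re O g -> O x ->
  dword_re [:: i, j & w] g x = dword_re [:: j, i & w] g x.
Proof.
move=> oO sg Ox; apply: (@derive_swap _ _ (dword_re w g)).
- apply: (near_open oO Ox) => y Oy.
  split; [exact: (sg w y Oy).2|exact: (sg w y Oy).2|
    exact: (sg (j :: w) y Oy).2|exact: (sg (i :: w) y Oy).2].
- by have [] := sg [:: i, j & w] x Ox.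
- by have [] := sg [:: j, i & w] x Ox.
Qed.

Lemma dword_re_front O g i w1 w2 x : open O -> smooth_on_re O g -> O x ->
  dword_re (w1 ++ i :: w2) g x = dword_re (i :: w1 ++ w2) g x.
Proof.
move=> oO sg; elim: w1 x => [//|j w1 IH] x Ox.
rewrite (dword_re_swap i j _ oO sg Ox) /=.
by apply: near_eq_derive; apply: (near_open oO Ox).
Qed.

(** By Schwarz's theorem the first letter of one word can be moved to the front
    of the other one. *)
Lemma dword_re_perm O g w1 w2 x : open O -> smooth_on_re O g -> perm_eq w1 w2 ->
  O x -> dword_re w1 g x = dword_re w2 g x.
Proof.
move=> oO sg; elim: w1 w2 x => [|i w1 IH] w2 x.
  by rewrite perm_sym => /perm_nilP ->.
move=> p12 Ox; have iw2 : i \in w2 by rewrite -(perm_mem p12) mem_head.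
case/splitPr: iw2 p12 => a b; rewrite perm_sym -cat1s perm_catCA /= perm_cons perm_sym.
move=> p12; rewrite (dword_re_front i a b oO sg Ox) /=.
by apply: near_eq_derive; apply: (near_open oO Ox) => y Oy; exact: IH.
Qed.

(** Seminorms only see the sorted words coming from multi-indices; together with
    [dword_re_perm] this makes them control all words. *)
Lemma perm_word_of (w : seq 'I_n) :
  perm_eq w (word_of [ffun i => count_mem i w]).
Proof.
apply/allP => /= i _; apply/eqP; rewrite /word_of count_flatten -map_comp.
rewrite sumnE big_map big_enum /= (bigD1 i) //= ffunE count_nseq /= eqxx mul1n.
rewrite big1 ?addn0 // => j /negbTE ji; by rewrite count_nseq /= ji mul0n.
Qed.

Lemma mdeg_count (w : seq 'I_n) : mdeg [ffun i => count_mem i w] = size w.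
Proof.
rewrite /mdeg -sum1_size.
rewrite (eq_bigr (fun i => \sum_(j <- w) (j == i : nat))%N); last first.
  by move=> i _; rewrite ffunE -sum1_count big_mkcond.
rewrite exchange_big /=; apply: eq_bigr => j _.
by rewrite (bigD1 j) //= eqxx big1 // => i /negbTE; rewrite eq_sym => ->.
Qed.

Lemma size_word_of (a : multi_index n) : size (word_of a) = mdeg a.
Proof.
rewrite /word_of size_flatten /shape -map_comp sumnE big_map big_enum /=.
by apply: eq_bigr => i _; rewrite size_nseq.
Qed.

Lemma dword_re_affine g (l : R) (b : V) w : smooth_on_re setT g ->
  forall x, dword_re w (fun x => g (l *: x + b)) x =
            l ^+ size w * dword_re w g (l *: x + b).
Proof.
move=> sg; elim: w => [|i w IH] x; first by rewrite expr0 mul1r.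
rewrite [LHS]/=; rewrite (_ : dword_re w _ =
   l ^+ size w \*: (fun x => dword_re w g (l *: x + b))); last exact/funext.
have dw : is_derive x (d_ i) (fun x => dword_re w g (l *: x + b))
    (l * dword_re (i :: w) g (l *: x + b)).
  by apply: is_derive_affine; have [] := sg w (l *: x + b) I.
rewrite deriveZ; last by have [] := dw.
by have [_ ->] := dw; rewrite /= exprSr -mulrA.
Qed.

Lemma smooth_affine g (l : R) (b : V) : smooth_on_re setT g ->
  smooth_on_re setT (fun x => g (l *: x + b)).
Proof.
move=> sg w x _.
rewrite (_ : dword_re w _ = l ^+ size w \*: (fun x => dword_re w g (l *: x + b)));
  last by apply/funext => y; exact: dword_re_affine.
split.
  apply: continuousZl_tmp; apply: (continuous_comp (@continuous_affine _ _ l b x)).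
  by have [] := sg w (l *: x + b) I.
move=> i; apply: derivableZ.
by have [] := is_derive_affine (g := dword_re w g) ((sg w (l *: x + b) I).2 i).
Qed.

Lemma dword_re_lin O f g (k : R) w : open O -> smooth_on_re O f -> smooth_on_re O g ->
  forall x, O x -> dword_re w (fun x => k * f x + g x) x =
                   k * dword_re w f x + dword_re w g x.
Proof.
move=> oO sf sg; elim: w => [//|i w IH] x Ox /=.
rewrite (@near_eq_derive _ _ _ _ (k \*: dword_re w f + dword_re w g)); last first.
  by apply: (near_open oO Ox) => y /IH.
have [_ /(_ i) df] := sf w x Ox; have [_ /(_ i) dg] := sg w x Ox.
rewrite deriveD; [|by apply: derivableZ; exact: df|exact: dg].
by rewrite deriveZ; [|exact: df].
Qed.

Lemma smooth_lin O f g (k : R) : open O -> smooth_on_re O f -> smooth_on_re O g ->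
  smooth_on_re O (fun x => k * f x + g x).
Proof.
move=> oO sf sg w x Ox.
have nE : \forall y \near x, (k \*: dword_re w f + dword_re w g) y =
   dword_re w (fun x => k * f x + g x) y.
  by apply: (near_open oO Ox) => y Oy; rewrite (dword_re_lin _ _ oO sf sg Oy).
have [cf df] := sf w x Ox; have [cg dg] := sg w x Ox; split.
  have c : {for x, continuous (k \*: dword_re w f + dword_re w g)}.
    apply: continuousD; [apply: continuousZl_tmp; exact: cf|exact: cg].
  exact: continuous_near_eq nE c.
move=> i; apply: near_eq_derivable nE _.
by apply: derivableD => //; exact: derivableZ.
Qed.

End Words.

(** * Taylor's formula *)

Section Taylor.
Variables (R : realType) (n : nat).
Local Notation V := 'rV[R]_n.
Local Notation d_ i := (delta_mx 0 i : V).

(** Sums over words rather than over multi-indices, so that no multinomial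
    coefficients appear in Taylor's formula. *)
Fixpoint words (k : nat) : seq (seq 'I_n) :=
  if k is k'.+1 then [seq i :: w | i <- enum 'I_n, w <- words k'] else [:: [::]].

Lemma size_words k w : w \in words k -> size w = k.
Proof.
elim: k w => [|k IH] w /=; first by rewrite inE => /eqP ->.
by case/allpairsP => -[i w'] /= [_ /IH <- ->].
Qed.

Lemma card_words k : size (words k) = (n ^ k)%N.
Proof. by elim: k => [//|k IH]; rewrite /= size_allpairs IH size_enum_ord expnS. Qed.

Definition word_mono (w : seq 'I_n) (h : V) : R := \prod_(i <- w) h 0 i.

(** This is the k-th power of the operator h . grad, applied to g at x. *)
Definition taylor_term (k : nat) (g : V -> R) (x h : V) : R :=
  \sum_(w <- words k) word_mono w h * dword_re w g x.

Lemma taylor_term0 g x h : taylor_term 0 g x h = g x.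
Proof. by rewrite /taylor_term /= big_seq1 /word_mono big_nil mul1r. Qed.

Lemma word_mono_le w h (r : R) : `|h| <= r -> `|word_mono w h| <= r ^+ size w.
Proof.
move=> hr; rewrite /word_mono; elim: w => [|i w IH].
  by rewrite big_nil normr1 expr0.
rewrite big_cons normrM /= exprS ler_pM // (le_trans _ hr) //; exact: row_coord_le.
Qed.

Lemma taylor_term_le k g x h r M : `|h| <= r ->
  (forall w, size w = k -> `|dword_re w g x| <= M) ->
  `|taylor_term k g x h| <= (n ^ k)%:R * (r ^+ k * M).
Proof.
move=> hr gM; apply: (le_trans (ler_norm_sum _ _ _)).
rewrite -card_words -sum1_size natr_sum mulr_suml big_seq [leRHS]big_seq.
apply: ler_sum => w /size_words sw; rewrite mul1r normrM ler_pM //.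
  by rewrite -sw word_mono_le.
exact: gM.
Qed.

Lemma derive_taylor_term O g x h k s : open O -> smooth_on_re O g -> O (x + s *: h) ->
  is_derive (s : R) (1 : R) (fun s : R => taylor_term k g (x + s *: h) h)
    (taylor_term k.+1 g (x + s *: h) h).
Proof.
move=> oO sg Ox.
have -> : taylor_term k.+1 g (x + s *: h) h = \sum_(w <- words k) word_mono w h *
    \sum_(i < n) h 0 i * dword_re (i :: w) g (x + s *: h).
  rewrite /taylor_term /= big_flatten big_map.
  rewrite [RHS](eq_bigr _ (fun w _ => mulr_sumr _ _ _ _)) [RHS]exchange_big /=.
  rewrite big_enum /=.
  apply: eq_bigr => i _; rewrite big_map; apply: eq_bigr => w _.
  by rewrite /word_mono big_cons [_ * \prod_(j <- w) _]mulrC mulrA.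
rewrite /taylor_term; elim: (words k) => [|w ws IH].
  rewrite big_nil (_ : (fun _ => _) = cst 0); first exact: is_derive_cst.
  by apply/funext => t; rewrite big_nil.
rewrite big_cons (_ : (fun _ => _) = (word_mono w h \*: (fun s : R => dword_re w g (x + s *: h)))
    + (fun s : R => \sum_(w <- ws) word_mono w h * dword_re w g (x + s *: h))); last first.
  by apply/funext => t; rewrite big_cons.
apply: is_deriveD; apply: is_deriveZ.
have [dw <-] := smooth_is_derive h oO Ox (smooth_dword w sg).
exact: derivable_lineP.
Qed.

(** The Taylor polynomial of degree q at x + s h, evaluated at x + h: it goes from
    the Taylor polynomial at x, for s = 0, to g (x + h), for s = 1. *)
Definition taylor_sum (q : nat) g (x h : V) (s : R) : R :=
  \sum_(k < q.+1) taylor_term k g (x + s *: h) h * ((1 - s) ^+ k / k`!%:R).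

(** The weights (1 - s)^k / k! make the derivatives of consecutive terms
    cancel, so that only the term of order q.+1 is left. *)
Lemma derive_taylor_sum O g x h q s : open O -> smooth_on_re O g -> O (x + s *: h) ->
  is_derive (s : R) (1 : R) (taylor_sum q g x h)
    (taylor_term q.+1 g (x + s *: h) h * ((1 - s) ^+ q / q`!%:R)).
Proof.
move=> oO sg Ox; elim: q => [|q IH].
  rewrite (_ : taylor_sum 0 g x h = (fun s : R => taylor_term 0 g (x + s *: h) h)).
    rewrite expr0 fact0 divr1 mulr1; exact: (derive_taylor_term 0 oO sg Ox).
  by apply/funext => t; rewrite /taylor_sum big_ord1 expr0 fact0 divr1 mulr1.
rewrite (_ : taylor_sum q.+1 g x h = taylor_sum q g x h +
   (fun s : R => taylor_term q.+1 g (x + s *: h) h) *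
   (fun s : R => (q.+1)`!%:R^-1 *: (1 - s) ^+ q.+1)); last first.
  apply/funext => t; rewrite /taylor_sum big_ord_recr /=; congr (_ + _ * _).
  by rewrite mulrC.
have dp : is_derive s (1 : R) (fun s : R => (q.+1)`!%:R^-1 *: (1 - s) ^+ q.+1)
    (- ((1 - s) ^+ q / q`!%:R)).
  have d1 : is_derive s (1 : R) (fun s : R => 1 - s) (- 1).
    have -> : (fun s : R => 1 - s) = cst 1 - id by apply/funext.
    by apply: is_derive_eq; rewrite sub0r.
  have := is_deriveZ (q.+1)`!%:R^-1 (is_deriveX q.+1 d1).
  rewrite (_ : _ \*: _ = (fun s : R => (q.+1)`!%:R^-1 *: (1 - s) ^+ q.+1)); last first.
    by apply/funext => t /=; rewrite exprfctE.
  move/is_derive_eq; apply; rewrite -[LHS]/(_ * (_ * _)) /= mulrN1 mulrN.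
  congr (- _); rewrite factS natrM invfM mulrCA !mulrA divff ?mul1r 1?mulrC //.
have := is_deriveD IH (is_deriveM (derive_taylor_term q.+1 oO sg Ox) dp).
have alg (a b c d f : R) : a * b + (a * - b + (f^-1 * c) * d) = d * (c / f) by ring.
move/is_derive_eq; apply; exact: alg.
Qed.

(** The mean value theorem for [taylor_sum] between 0 and 1. *)
Lemma taylor O g x h q r M : open O -> smooth_on_re O g -> `|h| <= r ->
  (forall s : R, 0 <= s <= 1 -> O (x + s *: h)) ->
  (forall w, size w = q.+1 -> forall s : R, 0 <= s <= 1 ->
     `|dword_re w g (x + s *: h)| <= M) ->
  `|g (x + h) - \sum_(k < q.+1) taylor_term k g x h / k`!%:R|
    <= (n ^ q.+1)%:R * (r ^+ q.+1 * M).
Proof.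
move=> oO sg hr Oh gM.
have [s s01 E] := MVT01 (fun s s01 => derive_taylor_sum q oO sg (Oh s s01)).
have E1 : taylor_sum q g x h 1 = g (x + h).
  rewrite /taylor_sum big_ord_recl /= big1 => [|i _].
    by rewrite scale1r taylor_term0 expr0 fact0 divr1 mulr1 addr0.
  by rewrite subrr expr0n /= mul0r mulr0.
have E0 : taylor_sum q g x h 0 = \sum_(k < q.+1) taylor_term k g x h / k`!%:R.
  apply: eq_bigr => k _; rewrite scale0r addr0 subr0 expr1n mul1r; by [].
rewrite -E1 -E0 E normrM -[leRHS]mulr1 ler_pM //.
  by apply: taylor_term_le hr _ => w sw; exact: gM.
move/andP: s01 => [s0 s1].
rewrite ger0_norm; last by rewrite divr_ge0 // exprn_ge0 // subr_ge0.
rewrite ler_pdivrMr ?ltr0n ?fact_gt0 // mul1r.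
apply: (@le_trans _ _ 1); last by rewrite ler1n fact_gt0.
by rewrite exprn_ile1 // ?subr_ge0 // lerBlDr lerDl.
Qed.

End Taylor.

(** * Integrals of continuous functions with bounded support *)

Section CompactSupport.
Variables (R : realType) (n : nat).
Local Notation V := 'rV[R]_n.
Local Notation d_ i := (delta_mx 0 i : V).

Definition cball (x : V) (r : R) : set V := [set y | `|y - x| <= r].

Lemma cball_le x r r' : r <= r' -> cball x r `<=` cball x r'.
Proof. by move=> rr y /le_trans; exact. Qed.

Lemma closed_cball x r : closed (cball x r).
Proof.
have -> : cball x r = (fun y : V => `|y - x|) @^-1` [set s | s <= r] by [].
apply: closed_comp; last exact: closed_le.
move=> y _; apply: (@continuous_comp _ _ _ (fun y : V => y - x) (fun y : V => `|y|)).
  have idy : {for y, continuous (fun y : V => y)} by move=> A.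
  by apply: continuousB idy _; exact: cst_continuous.
exact: norm_continuous.
Qed.

Lemma compact_cball x r : compact (cball x r).
Proof.
apply: bounded_closed_compact; last exact: closed_cball.
exists (r + `|x|); split; first exact: num_real.
move=> M rM y /= yr; apply: le_trans (ltW rM).
by rewrite -lerBlDr (le_trans _ yr) // lerB_dist.
Qed.

Lemma compact_continuous_bounded (K : set V) (f : V -> R) : compact K ->
  (forall x, K x -> {for x, continuous f}) ->
  exists2 M : R, 0 <= M & forall x, K x -> `|f x| <= M.
Proof.
move=> cK cf.
have : compact (f @` K).
  apply: continuous_compact => //; apply: continuous_in_subspaceT => x.
  by rewrite inE; exact: cf.
move/compact_bounded => [M [_ HM]]; exists (Num.max 0 (M + 1)).
  by rewrite le_max lexx.
move=> x Kx; apply: (HM (Num.max 0 (M + 1))).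
  by rewrite lt_max ltrDl ltr01 orbT.
by exists x.
Qed.

(** The radius is part of the notion because it bounds the integral: see
    [intV_bound]. *)
Definition Cc (r : R) (f : V -> R) := continuous f /\ vanishes_outside r f.

Lemma Cc_bounded r f : Cc r f -> exists2 M : R, 0 <= M & forall x, `|f x| <= M.
Proof.
move=> [cf fr]; have [x _|M M0 HM] := @compact_continuous_bounded _ f (@compact_cball 0 r).
  exact: cf.
exists M => // x; have [xr|xr] := leP `|x| r.
  by apply: HM; rewrite /cball /= subr0.
by rewrite fr // normr0.
Qed.

Lemma Cc_widen r r' f : r <= r' -> Cc r f -> Cc r' f.
Proof. by move=> rr [cf fr]; split => // x xr; apply: fr; exact: le_lt_trans xr. Qed.

Lemma CcD r f g : Cc r f -> Cc r g -> Cc r (fun x => f x + g x).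
Proof.
move=> [cf fr] [cg gr]; split; last by move=> x xr; rewrite fr // gr // addr0.
by move=> x; apply: continuousD; [exact: cf|exact: cg].
Qed.

Lemma CcMl r (c f : V -> R) : continuous c -> Cc r f -> Cc r (fun x => c x * f x).
Proof.
move=> cc [cf fr]; split; last by move=> x xr; rewrite fr // mulr0.
by move=> x; apply: continuousM; [exact: cc|exact: cf].
Qed.

Lemma CcZ r (c : R) f : Cc r f -> Cc r (fun x => c * f x).
Proof. by apply: CcMl; exact: cst_continuous. Qed.

Lemma Cc0 r : Cc r (fun=> 0).
Proof. by split => //; exact: cst_continuous. Qed.

Lemma Cc_sum r (I : Type) (s : seq I) (f : I -> V -> R) :
  (forall i, Cc r (f i)) -> Cc r (fun x => \sum_(i <- s) f i x).
Proof.
move=> Cf; elim: s => [|i s IH].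
  rewrite (_ : (fun _ => _) = fun=> 0); first exact: Cc0.
  by apply/funext => x; rewrite big_nil.
rewrite (_ : (fun _ => _) = fun x => f i x + \sum_(j <- s) f j x); first exact: CcD.
by apply/funext => x; rewrite big_cons.
Qed.

Lemma intV_add r f g : Cc r f -> Cc r g -> intV (fun x => f x + g x) = intV f + intV g.
Proof.
move=> Cf Cg; have [M _ fM] := Cc_bounded Cf; have [N _ gN] := Cc_bounded Cg.
apply: (@intVD _ _ r _ _ (Num.max M N)); [exact: Cf.1|exact: Cg.1|exact: Cf.2|exact: Cg.2| |].
- by move=> x; rewrite le_max fM.
- by move=> x; rewrite le_max gN orbT.
Qed.

Lemma intV_scale r (k : R) f : Cc r f -> intV (fun x => k * f x) = k * intV f.
Proof.
move=> Cf; have [M _ fM] := Cc_bounded Cf.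
exact: (intVZ k Cf.1 Cf.2 fM).
Qed.

Lemma intV_zero : intV (fun _ : V => 0 : R) = 0.
Proof.
rewrite -[RHS](mul0r (intV (fun _ : V => 0 : R))) -(intV_scale _ (Cc0 0)).
by congr intV; apply/funext => x; rewrite mul0r.
Qed.

Lemma intV_sum r (I : Type) (s : seq I) (f : I -> V -> R) : (forall i, Cc r (f i)) ->
  intV (fun x => \sum_(i <- s) f i x) = \sum_(i <- s) intV (f i).
Proof.
move=> Cf; elim: s => [|i s IH].
  rewrite big_nil -[RHS]intV_zero; congr intV.
  by apply/funext => x; rewrite big_nil.
rewrite big_cons -IH -(intV_add (Cf i) (Cc_sum s Cf)); congr intV.
by apply/funext => x; rewrite big_cons.
Qed.

Lemma intV_bound r f M : Cc r f -> (forall x, `|f x| <= M) -> `|intV f| <= M * box_vol n r.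
Proof. by move=> [cf fr]; exact: intV_le. Qed.

Lemma intV_change r f (e : R) (a : V) : 0 < e -> Cc r f ->
  intV f = e ^+ n * intV (fun x => f (e *: x + a)).
Proof.
move=> e0 Cf; have [M _ fM] := Cc_bounded Cf.
by rewrite (intV_affine a e0 Cf.1 Cf.2 fM).
Qed.

(** Translation invariance makes the difference quotients of f integrate
    to 0, and they converge boundedly to the derivative. *)
Lemma intV_derive r f i : Cc r f -> Cc r (dword_re [:: i] f) ->
  (forall x i, derivable f x (d_ i)) -> intV (dword_re [:: i] f) = 0.
Proof.
move=> Cf Cd df; have [M _ HM] := Cc_bounded Cd.
pose t (k : nat) : R := k.+1%:R^-1.
have t0 k : 0 < t k by rewrite invr_gt0.
have t1 k : t k <= 1 by rewrite invf_le1 // ler1n.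
pose r' := r + `|d_ i|.
have Cs k : Cc r' (fun x => f (1 *: x + t k *: d_ i)).
  split; first exact: continuous_comp_affine Cf.1.
  move=> x; rewrite /r' scale1r => xr; apply: Cf.2.
  rewrite -(ltrD2r `|d_ i|) (lt_le_trans xr) //.
  rewrite -{1}[x](addrK (t k *: d_ i)) (le_trans (ler_normB _ _)) // lerD2l.
  by rewrite normrZ ler_piMl // ger0_norm // ltW.
have Cf' : Cc r' f by apply: Cc_widen Cf; rewrite lerDl.
have Cd' : Cc r' (dword_re [:: i] f) by apply: Cc_widen Cd; rewrite lerDl.
pose F k x := (t k)^-1 * (f (1 *: x + t k *: d_ i) + -1 * f x).
have CF k : Cc r' (F k) by apply: CcZ; apply: CcD => //; exact: CcZ.
have F0 k : intV (F k) = 0.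
  rewrite (intV_scale _ (CcD (Cs k) (CcZ (-1) Cf'))) (intV_add (Cs k) (CcZ (-1) Cf')).
  rewrite (intV_scale _ Cf') [X in _ + _ * X](intV_change (t k *: d_ i) ltr01 Cf').
  by rewrite expr1n mul1r mulN1r subrr mulr0.
have FM k x : `|F k x| <= M.
  have [s _|s _ E] := @line_MVT _ _ f x (d_ i) (t k); first exact: df.
  rewrite /F mulN1r scale1r E mulKf ?gt_eqF //; exact: HM.
have Fc x : F ^~ x @ \oo --> dword_re [:: i] f x.
  have tc : t k @[k --> \oo] --> (0 : R)^'.
    move=> A /cvg_harmonic[N _ NA]; exists N => // k /NA; apply.
    by rewrite gt_eqF // t0.
  have := cvg_comp _ _ tc (df x i).
  rewrite (_ : _ \o _ = F ^~ x) //; apply/funext => k /=.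
  by rewrite /F scale1r mulN1r [X in f X]addrC.
have := intV_cvg (fun k => (CF k).1) Cd'.1 (fun k => (CF k).2) FM Fc.
under eq_fun do rewrite F0.
by move/(cvg_unique _ (cvg_cst 0)) => <-.
Qed.


Lemma dword_re0 (w : seq 'I_n) : dword_re w (fun _ : V => 0 : R) = fun=> 0.
Proof.
elim: w => [//|i w IH]; apply/funext => x /=.
by rewrite IH; exact: (derive_cst (0 : R)).
Qed.

Lemma smooth_zero O : smooth_on_re O (fun _ : V => 0 : R).
Proof.
move=> w x _; rewrite dword_re0; split; first exact: cst_continuous.
by move=> i; exact: derivable_cst.
Qed.

Lemma smoothZ O f (k : R) : open O -> smooth_on_re O f ->
  smooth_on_re O (fun x : V => k * f x).
Proof.
move=> oO sf; have := smooth_lin k oO sf (@smooth_zero O).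
by under [X in smooth_on_re _ X]funext do rewrite addr0.
Qed.

Lemma dword_reZ O f (k : R) w : open O -> smooth_on_re O f -> forall x, O x ->
  dword_re w (fun x : V => k * f x) x = k * dword_re w f x.
Proof.
move=> oO sf x Ox; have := dword_re_lin k w oO sf (@smooth_zero O) Ox.
by rewrite dword_re0 addr0; under [X in dword_re _ X]funext do rewrite addr0.
Qed.

Lemma smooth_dilation (g : V -> R) (k l : R) : smooth_on_re setT g ->
  smooth_on_re setT (fun x : V => k * g (l *: x)).
Proof.
move=> sg; apply: smoothZ; first exact: openT.
have := smooth_affine l 0 sg.
by under [X in smooth_on_re _ X]funext do rewrite addr0.
Qed.

Lemma vanishes_outside_dword r (f : V -> R) w :
  vanishes_outside r f -> vanishes_outside r (dword_re w f).
Proof.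
move=> fr x xr; have xo : open [set x : V | r < `|x|].
  rewrite (_ : [set _ | _] = ~` cball 0 r); first by rewrite openC; exact: closed_cball.
  by apply/seteqP; split => y /=; rewrite /cball /= subr0 ltNge => /negP.
rewrite (@dword_re_local _ _ _ f (fun=> 0) w xo) //.
elim: w x xr => [//|i w IH] x xr /=.
rewrite (@near_eq_derive _ _ _ _ (cst 0)); first by rewrite derive_cst.
exact: (near_open xo xr).
Qed.

Lemma Cc_smooth r f w : smooth_on_re setT f -> vanishes_outside r f -> Cc r (dword_re w f).
Proof.
move=> sf fr; split; last exact: vanishes_outside_dword.
by move=> x; have [] := sf w x I.
Qed.

(** * Integration by parts *)

Section Parts.
Variables (O S : set V) (oO : open O) (cS : closed S) (SO : S `<=` O).
Definition vanishes_off (f : V -> R) := forall x, ~ S x -> f x = 0.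

Lemma vanishes_off_near f x : vanishes_off f -> ~ S x -> \forall y \near x, f y = 0.
Proof.
move=> fS Sx; apply: (@near_open _ _ (~` S)) => //.
by rewrite openC.
Qed.

Lemma vanishes_off_dword f w : vanishes_off f -> vanishes_off (dword_re w f).
Proof.
move=> fS x Sx; rewrite (@dword_re_local _ _ (~` S) f (fun=> 0) w) ?openC //.
elim: w x Sx => [//|i w IH] x Sx /=.
rewrite (@near_eq_derive _ _ _ _ (cst 0)); first by rewrite derive_cst.
by apply: (@near_open _ _ (~` S)); rewrite ?openC.
Qed.

(** Nothing is known about u outside O, but away from S the product is locally
    zero. *)
Lemma continuous_offM (u f : V -> R) : (forall x, O x -> {for x, continuous u}) -> continuous f ->
  vanishes_off f -> continuous (fun x => u x * f x).
Proof.
move=> cu cf fS x; have [/SO Ox|Sx] := pselect (S x).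
  by apply: continuousM; [exact: cu|exact: cf].
apply: (@continuous_near_eq _ _ (fun=> 0)); last exact: cst_continuous.
by apply: filterS (vanishes_off_near fS Sx) => y ->; rewrite mulr0.
Qed.

Lemma Cc_offM r (u f : V -> R) : (forall x, O x -> {for x, continuous u}) -> Cc r f ->
  vanishes_off f -> Cc r (fun x => u x * f x).
Proof.
move=> cu [cf fr] fS; split; first exact: continuous_offM.
by move=> x xr; rewrite fr // mulr0.
Qed.

Lemma is_derive_offM u f i x : smooth_on_re O u -> smooth_on_re setT f -> vanishes_off f ->
  is_derive x (d_ i) (fun x => u x * f x)
    (u x * dword_re [:: i] f x + dword_re [:: i] u x * f x).
Proof.
move=> su sf fS; have [/SO Ox|Sx] := pselect (S x).
  have := is_deriveM (derivableP (@smooth_derivable _ _ _ _ _ i su Ox))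
                     (derivableP (@smooth_derivable _ _ _ _ x i sf I)).
  by move/is_derive_eq; apply; congr (_ + _); exact: mulrC.
apply: (@near_eq_is_derive _ _ _ (fun=> 0)).
  by apply: filterS (vanishes_off_near fS Sx) => y ->; rewrite mulr0.
rewrite fS // (vanishes_off_dword _ fS) // !mulr0 addr0; exact: is_derive_cst.
Qed.

Lemma intV_parts1 r u f i : smooth_on_re O u -> smooth_on_re setT f -> vanishes_outside r f ->
  vanishes_off f -> intV (fun x => u x * dword_re [:: i] f x) =
           - intV (fun x => dword_re [:: i] u x * f x).
Proof.
move=> su sf fr fS.
have C0 : Cc r (fun x => u x * f x).
  apply: Cc_offM => //; [by move=> x; exact: smooth_continuous|exact: (Cc_smooth [::])].
have C1 : Cc r (fun x => u x * dword_re [:: i] f x).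
  apply: Cc_offM; [by move=> x; exact: smooth_continuous|exact: Cc_smooth|exact: vanishes_off_dword].
have C2 : Cc r (fun x => dword_re [:: i] u x * f x).
  by apply: Cc_offM => //; [move=> x Ox; have [] := su [:: i] x Ox|exact: (Cc_smooth [::])].
have E : dword_re [:: i] (fun x => u x * f x) =
    fun x => u x * dword_re [:: i] f x + dword_re [:: i] u x * f x.
  by apply/funext => x; have [_ E] := is_derive_offM i x su sf fS; exact: E.
apply/eqP; rewrite -addr_eq0 -(intV_add C1 C2) -E; apply/eqP.
apply: (@intV_derive r) => //.
  by rewrite E; exact: CcD.
by move=> x j; have [] := is_derive_offM j x su sf fS.
Qed.

(** Each integration by parts takes the first letter of w and puts it in front of
    the word acting on u; Schwarz's theorem undoes the resulting reversal. *)
Lemma intV_parts r u f w : smooth_on_re O u -> smooth_on_re setT f -> vanishes_outside r f ->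
  vanishes_off f -> intV (fun x => u x * dword_re w f x) =
           (-1) ^+ size w * intV (fun x => dword_re w u x * f x).
Proof.
move=> su sf fr fS.
have -> : (fun x => dword_re w u x * f x) = (fun x => dword_re (rev w) u x * f x).
  apply/funext => x; have [/SO Ox|Sx] := pselect (S x).
    by rewrite (dword_re_perm oO su _ Ox (w2 := w)) // perm_rev.
  by rewrite fS // !mulr0.
elim: w u su => [|i w IH] u su; first by rewrite expr0 mul1r.
rewrite -[i :: w]cat1s.
rewrite [X in intV X](_ : _ = fun x => u x * dword_re [:: i] (dword_re w f) x) //.
rewrite (intV_parts1 i su (smooth_dword w sf) (vanishes_outside_dword w fr)
  (vanishes_off_dword w fS)).
rewrite IH; last exact: smooth_dword.
rewrite /= rev_cons -cats1 exprS mulN1r mulNr; congr (- (_ * intV _)).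
by apply/funext => x; rewrite dword_re_cat.
Qed.

End Parts.

(** * Mollification by kernels with vanishing moments *)

Lemma word_mono_mono (w : seq 'I_n) (z : V) : word_mono w z = mono [ffun i => count_mem i w] z.
Proof.
rewrite /word_mono /mono; elim: w => [|i w IH].
  by rewrite big_nil big1 // => i _; rewrite ffunE expr0.
rewrite big_cons IH (bigD1 i) //= [RHS](bigD1 i) //= !ffunE /= eqxx exprS -mulrA.
congr (_ * (_ * _)); apply: eq_bigr => j /negbTE ji; rewrite !ffunE /=.
by rewrite eq_sym ji.
Qed.

Lemma word_monoZ (w : seq 'I_n) (e : R) (z : V) : word_mono w (e *: z) = e ^+ size w * word_mono w z.
Proof.
rewrite /word_mono; elim: w => [|i w IH]; first by rewrite !big_nil mulr1.
by rewrite !big_cons IH mxE exprS mulrACA.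
Qed.

Lemma continuous_word_mono (w : seq 'I_n) : continuous (fun z : V => word_mono w z).
Proof.
rewrite /word_mono; elim: w => [|i w IH].
  rewrite (_ : (fun _ => _) = fun=> 1); first exact: cst_continuous.
  by apply/funext => x; rewrite big_nil.
rewrite (_ : (fun _ => _) = fun z : V => z 0 i * \prod_(j <- w) z 0 j).
  move=> x; apply: continuousM; [exact: coord_continuous|exact: IH].
by apply/funext => x; rewrite big_cons.
Qed.

(** The derivatives are moved from the scaled kernel to g by parts, and then the
    Taylor polynomial of the result integrates to its constant term.  The constant
    depends on the kernel only, hence the bound is uniform in g, x and e.  The
    first conclusion makes integrals of sums of such functions additive. *)
Lemma kernel_approx (chi : V -> R) (rho : R) (q : nat) :
  smooth_on_re setT chi -> 0 <= rho -> vanishes_outside rho chi ->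
  (forall a, (1 <= mdeg a <= q)%N -> intV (fun z => mono a z * chi z) = 0) ->
  exists2 C : R, 0 <= C & forall (O : set V) (g : V -> R) (w : seq 'I_n) (e A : R) (x : V),
    open O -> smooth_on_re O g -> 0 < e -> 0 <= A -> cball x (e * rho) `<=` O ->
    (forall w', size w' = q.+1 -> forall y, cball x (e * rho) y ->
      `|dword_re w' (dword_re w g) y| <= A) ->
    Cc (`|x| + e * rho)
      (fun y => g y * dword_re w (fun x' => e ^- n * chi (e^-1 *: (y - x'))) x) /\
    `|intV (fun y => g y * dword_re w (fun x' => e ^- n * chi (e^-1 *: (y - x'))) x)
      - intV chi * dword_re w g x| <= C * (A * e ^+ q.+1).
Proof.
move=> sc rho0 cr mom.
have Cchi : Cc rho chi by exact: (Cc_smooth [::]).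
have [M M0 HM] := Cc_bounded Cchi.
(* Taylor's remainder, the bound of chi, and the volume of its support. *)
exists ((n ^ q.+1)%:R * rho ^+ q.+1 * M * box_vol n rho).
  by rewrite !mulr_ge0 ?exprn_ge0 ?box_vol_ge0.
move=> O g w e A x oO sg e0 A0 SO gA.
have en0 : e != 0 by rewrite gt_eqF.
have e0' : 0 <= e by exact: ltW.
pose chi0 y := e ^- n * chi (e^-1 *: y).
pose chie y := chi0 (y - x).
have schi0 : smooth_on_re setT chi0 by exact: smooth_dilation.
have schie : smooth_on_re setT chie by exact: smooth_on_re_shift.
have ballE y : e * rho < `|y - x| -> chie y = 0.
  move=> yx; rewrite /chie /chi0 cr ?mulr0 // normrZ.
  by rewrite ger0_norm ?invr_ge0 // ltr_pdivlMl.
have off_chie : vanishes_off (cball x (e * rho)) chie.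
  by move=> y /negP; rewrite /cball /= -ltNge; exact: ballE.
pose r' := `|x| + e * rho.
have bchie : vanishes_outside r' chie.
  move=> y yr; apply: ballE; rewrite -(ltrD2l `|x|) (lt_le_trans yr) //.
  by rewrite -[X in `|X| <= _](subrK x) addrC ler_normD.
have -> : (fun y => g y * dword_re w (fun x' => e ^- n * chi (e^-1 *: (y - x'))) x) =
          (fun y => (-1) ^+ size w * (g y * dword_re w chie y)).
  apply/funext => y; rewrite mulrCA; congr (_ * _).
  rewrite /chie (dword_re_shift w chi0 x).
  have := dword_re_affine (-1) y w schi0 x; rewrite scaleN1r addrC => <-.
  congr (dword_re w _ x); apply/funext => x'; by rewrite scaleN1r addrC.
have Cg (u : V -> R) : smooth_on_re O u -> Cc r' (fun y => u y * chie y).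
  move=> su; apply: (Cc_offM (@closed_cball _ _) SO) off_chie.
    by move=> y; exact: smooth_continuous.
  exact: (Cc_smooth [::]).
have Cgw : Cc r' (fun y => g y * dword_re w chie y).
  apply: (Cc_offM (@closed_cball _ _) SO).
  - by move=> y; exact: smooth_continuous.
  - exact: Cc_smooth.
  - by apply: vanishes_off_dword off_chie; exact: closed_cball.
split; first exact: CcZ.
rewrite (intV_scale _ Cgw).
rewrite (intV_parts oO (@closed_cball _ _) SO w sg schie bchie off_chie).
rewrite signrMK.
have sG := smooth_dword w sg; set G := dword_re w g in sG gA *.
pose H y := G y * chie y.
have CH : Cc r' H := Cg _ sG.
have HE z : H (e *: z + x) = e ^- n * (G (e *: z + x) * chi z).
  by rewrite /H /chie /chi0 addrK scalerA mulVf // scale1r mulrCA.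
have CHe : Cc rho (fun z => H (e *: z + x)).
  split; first exact: continuous_comp_affine CH.1.
  by move=> z zr; rewrite HE cr // !mulr0.
have EG : (fun z => G (e *: z + x) * chi z) = (fun z => e ^+ n * H (e *: z + x)).
  by apply/funext => z; rewrite HE mulrA divff ?mul1r // expf_neq0.
have CG : Cc rho (fun z => G (e *: z + x) * chi z) by rewrite EG; exact: CcZ.
rewrite (intV_change x e0 CH) -(intV_scale _ CHe) -EG.
pose P z := \sum_(k < q.+1) taylor_term k G x (e *: z) / k`!%:R.
pose c (k : 'I_q.+1) (v : seq 'I_n) : R := e ^+ size v * dword_re v G x / k`!%:R.
pose m (v : seq 'I_n) (z : V) := word_mono v z * chi z.
have Cm v : Cc rho (m v) by apply: CcMl => //; exact: continuous_word_mono.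
have PE : (fun z => P z * chi z) =
    (fun z => \sum_(k < q.+1) \sum_(v <- words n k) c k v * m v z).
  apply/funext => z; rewrite /P mulr_suml; apply: eq_bigr => k _.
  rewrite /taylor_term !mulr_suml; apply: eq_bigr => v _.
  by rewrite word_monoZ /c /m; ring.
have Ccm (k : 'I_q.+1) v : Cc rho (fun z => c k v * m v z) by exact: CcZ.
have Csum (k : 'I_q.+1) : Cc rho (fun z => \sum_(v <- words n k) c k v * m v z).
  by apply: Cc_sum => v; exact: Ccm.
have CP : Cc rho (fun z => P z * chi z) by rewrite PE; exact: Cc_sum.
have IP : intV (fun z => P z * chi z) = intV chi * G x.
  rewrite PE (intV_sum _ Csum) big_ord_recl big1 ?addr0 => [|k _].
    rewrite (intV_sum _ (Ccm _)) /= big_seq1 (intV_scale _ (Cm _)).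
    rewrite /c expr0 fact0 divr1 mul1r mulrC; congr (intV _ * _).
    by apply/funext => z; rewrite /m /word_mono big_nil mul1r.
  rewrite (intV_sum _ (Ccm _)) big_seq big1 // => v /size_words sv.
  rewrite (intV_scale _ (Cm _)) (_ : intV (m v) = 0) ?mulr0 //.
  rewrite -[RHS](mom [ffun i => count_mem i v]); last first.
    by rewrite mdeg_count sv /=; exact: ltn_ord.
  by congr intV; apply/funext => z; rewrite /m word_mono_mono.
rewrite -IP; have CNP := CcZ (-1) CP.
rewrite -mulN1r -(intV_scale _ CP) -(intV_add CG CNP).
apply: (le_trans (intV_bound (M := (n ^ q.+1)%:R * ((e * rho) ^+ q.+1 * A) * M)
   (CcD CG CNP) _)); last first.
  rewrite le_eqVlt; apply/orP; left; apply/eqP; rewrite exprMn; ring.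
move=> z; have [zr|zr] := leP `|z| rho; last first.
  rewrite cr // !mulr0 addr0 normr0.
  by rewrite !mulr_ge0 ?exprn_ge0 ?mulr_ge0.
rewrite mulN1r -mulrBl normrM ler_pM //.
have ezr : `|e *: z| <= e * rho by rewrite normrZ ger0_norm // ler_pM2l.
have xs (s : R) : 0 <= s <= 1 -> cball x (e * rho) (x + s *: (e *: z)).
  move=> /andP[s0 s1]; rewrite /cball /= addrC addKr normrZ ger0_norm //.
  by rewrite (le_trans _ ezr) // ler_piMl.
rewrite [e *: z + x]addrC; apply: (taylor oO sG ezr).
  by move=> s /xs /SO.
by move=> v sv s /xs; exact: gA.
Qed.

End CompactSupport.

(** * Seminorms, slices and scaled test functions *)

Section ComplexLayer.
Local Open Scope complex_scope.
Variables (R : realType) (n : nat).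
Local Notation V := 'rV[R]_n.
Local Notation C := R[i].
Local Notation d_ i := (delta_mx 0 i : V).

Definition re (f : V -> C) : V -> R := fun x => complex.Re (f x).
Definition im (f : V -> C) : V -> R := fun x => complex.Im (f x).

Lemma Re_le_absc (z : C) : `|complex.Re z| <= absc z.
Proof.
case: z => a b; rewrite /absc /= -sqrtr_sqr ler_wsqrtr //.
by rewrite lerDl sqr_ge0.
Qed.

Lemma Im_le_absc (z : C) : `|complex.Im z| <= absc z.
Proof.
case: z => a b; rewrite /absc /= -sqrtr_sqr ler_wsqrtr //.
by rewrite lerDr sqr_ge0.
Qed.

Lemma absc_le_ReIm (z : C) : absc z <= `|complex.Re z| + `|complex.Im z|.
Proof.
case: z => a b; rewrite /absc /= -[leRHS]ger0_norm ?addr_ge0 // -sqrtr_sqr.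
rewrite ler_wsqrtr // sqrrD !real_normK ?num_real // addrAC lerDl.
by rewrite mulrn_wge0 // mulr_ge0.
Qed.

Lemma absc_ge0 (z : C) : 0 <= absc z.
Proof. by case: z => a b; rewrite /absc /= sqrtr_ge0. Qed.

Lemma Re_realM (r : R) (z : C) : complex.Re (r%:C * z) = r * complex.Re z.
Proof. by case: z => a b /=; rewrite mul0r subr0. Qed.

Lemma Im_realM (r : R) (z : C) : complex.Im (r%:C * z) = r * complex.Im z.
Proof. by case: z => a b /=; rewrite mul0r addr0. Qed.

Lemma complexReM (z w : C) : complex.Re (z * w) =
  complex.Re z * complex.Re w - complex.Im z * complex.Im w.
Proof. by case: z w => a b [c d]. Qed.

Lemma complexImM (z w : C) : complex.Im (z * w) =
  complex.Re z * complex.Im w + complex.Im z * complex.Re w.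
Proof. by case: z w => a b [c d]. Qed.

Lemma complex_ext (z w : C) : complex.Re z = complex.Re w ->
  complex.Im z = complex.Im w -> z = w.
Proof. by case: z w => a b [c d] /= -> ->. Qed.

Lemma dpartial_re a (f : V -> C) x :
  complex.Re (dpartial a f x) = dword_re (word_of a) (re f) x.
Proof. by []. Qed.

Lemma dpartial_im a (f : V -> C) x :
  complex.Im (dpartial a f x) = dword_re (word_of a) (im f) x.
Proof. by []. Qed.

(** By induction on m: the last letter of a word is absorbed into the function. *)
Lemma smooth_words_bounded (O K : set V) (g : V -> R) (m : nat) :
  smooth_on_re O g -> compact K -> K `<=` O ->
  exists2 M : R, 0 <= M &
    forall w, (size w <= m)%N -> forall x, K x -> `|dword_re w g x| <= M.
Proof.
move=> + cK KO; elim: m g => [|m IH] g sg.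
  have [x Kx|M M0 HM] := @compact_continuous_bounded _ _ K g cK.
    by apply: (smooth_continuous sg); exact: KO.
  by exists M => // -[|//] _ x Kx; exact: HM.
have [M M0 HM] := IH g sg.
have /choice[N HN] : forall i : 'I_n, exists M : R, 0 <= M /\
    forall w, (size w <= m)%N -> forall x, K x -> `|dword_re w (dword_re [:: i] g) x| <= M.
  by move=> i; have [N N0 HN] := IH _ (smooth_dword [:: i] sg); exists N.
exists (M + \sum_(i < n) N i).
  by rewrite addr_ge0 // sumr_ge0 // => i _; have [] := HN i.
move=> w; case: (lastP w) => [|w' i] sw x Kx.
  by rewrite (le_trans (HM [::] _ x Kx)) // lerDl sumr_ge0 // => i _; have [] := HN i.
have [N0 HNi] := HN i; rewrite -cats1 dword_re_cat.
rewrite (le_trans (HNi w' _ x Kx)) //; first by move: sw; rewrite size_rcons.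
rewrite (bigD1 i) //= addrCA lerDl addr_ge0 // sumr_ge0 // => j _.
by have [] := HN j.
Qed.

Lemma sup_ge0 (A : set R) : (forall r, A r -> 0 <= r) -> 0 <= sup A.
Proof.
move=> A0; have [[[r Ar] ub]|ns] := pselect (has_sup A).
  by rewrite (le_trans (A0 _ Ar)) // ub_le_sup.
by rewrite sup_out.
Qed.

Lemma sup_le_ub (A : set R) (M : R) : 0 <= M -> (forall r, A r -> r <= M) -> sup A <= M.
Proof.
move=> M0 AM; have [-> |/set0P A0] := eqVneq A set0; first by rewrite sup0.
exact: ge_sup.
Qed.

Lemma seminorm_le (K : set V) m (g : V -> C) (M : R) : 0 <= M ->
  (forall x a, K x -> (mdeg a <= m)%N -> absc (dpartial a g x) <= M) ->
  seminorm K m g <= M.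
Proof.
by move=> M0 HM; apply: sup_le_ub => // r [x [a [Kx am ->]]]; exact: HM.
Qed.

(** As sup is 0 on unbounded sets, a seminorm bounds derivatives only once they
    are known to be bounded. *)
Lemma seminorm_ge (K : set V) m (g : V -> C) (M : R) :
  (forall x a, K x -> (mdeg a <= m)%N -> absc (dpartial a g x) <= M) ->
  forall x a, K x -> (mdeg a <= m)%N -> absc (dpartial a g x) <= seminorm K m g.
Proof.
move=> HM x a Kx am; apply: ub_le_sup; last by exists x, a.
by exists M => r [y [b [Ky bm ->]]]; exact: HM.
Qed.

Lemma smooth_seminorm_ge (O K : set V) m (g : V -> C) : smooth_on O g ->
  compact K -> K `<=` O ->
  forall x a, K x -> (mdeg a <= m)%N -> absc (dpartial a g x) <= seminorm K m g.
Proof.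
move=> [sr si] cK KO.
have [M _ HM] := smooth_words_bounded m sr cK KO.
have [N _ HN] := smooth_words_bounded m si cK KO.
apply: (@seminorm_ge _ _ _ (M + N)) => x a Kx am.
rewrite (le_trans (absc_le_ReIm _)) // lerD //.
  by apply: HM => //; rewrite size_word_of.
by apply: HN => //; rewrite size_word_of.
Qed.

Lemma seminorm_ge0 (K : set V) m (g : V -> C) : 0 <= seminorm K m g.
Proof. by apply: sup_ge0 => r [x [a [_ _ ->]]]; exact: absc_ge0. Qed.

(** A property of sets that passes to subsets and to unions of two sets holds for
    a compact set as soon as it holds locally: otherwise the complements of the
    sets having the property would generate a filter without cluster point. *)
Lemma compact_local_to_global (K : set V) (P : set V -> Prop) : compact K ->
  P set0 -> (forall A B, A `<=` B -> P B -> P A) ->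
  (forall A B, P A -> P B -> P (A `|` B)) ->
  (forall x, K x -> exists2 r : R, 0 < r & P (cball x r)) -> P K.
Proof.
move=> cK P0 PS PU PL; apply: contrapT => nPK.
pose F : set_system V := [set A | exists2 B, P B & K `\` B `<=` A].
have FF : ProperFilter F.
  split.
    move=> [B PB KB]; apply: nPK; apply: PS PB => x Kx.
    by apply: contrapT => Bx; apply: (KB x).
  split.
  - by exists set0.
  - move=> A A' [B PB BA] [B' PB' BA']; exists (B `|` B'); first exact: PU.
    by move=> x [Kx nB]; split; [apply: BA|apply: BA']; split => //;
      apply: contra_not nB; [left|right].
  - by move=> A A' AA' [B PB BA]; exists B => // x /BA /AA'.
have [x [Kx cx]] : K `&` cluster F !=set0.
  by apply: cK; exists set0 => //; exact: subDsetl.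
have [r r0 Pr] := PL x Kx.
have [y [[Ky ny] By]] : (K `\` cball x r) `&` ball x r !=set0.
  by apply: cx; [exists (cball x r)|exact: nbhsx_ballx].
apply: ny; move: By; rewrite -ball_normE /ball_ /= => /ltW.
by rewrite /cball /= distrC.
Qed.

Lemma compact_thickening (S O : set V) : compact S -> open O -> S `<=` O ->
  exists2 d : R, 0 < d & forall y z, S y -> `|z| <= d -> O (y + z).
Proof.
move=> cS oO SO.
pose P (A : set V) := exists2 d : R, 0 < d & forall y z, A y -> `|z| <= d -> O (y + z).
apply: (@compact_local_to_global S P) => //.
- by exists 1.
- by move=> A B AB [d d0 dB]; exists d => // y z /AB; exact: dB.
- move=> A B [d d0 dA] [d' d0' dB]; exists (Num.min d d'); first by rewrite lt_min d0.
  by move=> y z [Ay|By]; rewrite le_min => /andP[zd zd']; [exact: dA|exact: dB].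
- move=> x /SO Ox; have [r r0 rO] := near_norm (open_nbhs_nbhs (conj oO Ox)).
  exists (r / 3); first by rewrite divr_gt0.
  exists (r / 3); first by rewrite divr_gt0.
  move=> y z; rewrite /cball /= => yx zr; apply: rO.
  rewrite addrAC (le_lt_trans (ler_normD _ _)) //.
  by rewrite (le_lt_trans (lerD yx zr)) //; lra.
Qed.

Lemma supp_off (f : V -> C) x : ~ supp f x -> f x = 0.
Proof.
by move=> sx; apply: contrapT => fx; apply: sx; apply: subset_closure => /=; exact/eqP.
Qed.

Lemma supp_sub (f : V -> C) (S : set V) : closed S -> (forall x, ~ S x -> f x = 0) ->
  supp f `<=` S.
Proof.
move=> cS fS; rewrite (closure_id S).1 //; apply: closure_subset => x /= fx.
by apply: contrapT => /fS fx0; rewrite fx0 eqxx in fx.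
Qed.

Lemma test_cball (f : V -> C) : test setT f ->
  exists2 rho : R, 0 < rho & forall x, rho < `|x| -> f x = 0.
Proof.
move=> [_ cf _]; have [M [_ HM]] := compact_bounded cf.
exists (Num.max 1 (M + 1)); first by rewrite lt_max ltr01.
move=> x; rewrite gt_max => /andP[_ Mx]; apply: supp_off => sx.
have := HM (M + 1) _ x sx; rewrite ltrDl ltr01 => /(_ isT) /=.
by rewrite leNgt Mx.
Qed.

Lemma cball_supp (f : V -> C) rho : (forall x, rho < `|x| -> f x = 0) ->
  supp f `<=` cball 0 rho.
Proof.
move=> fr; apply: supp_sub; first exact: closed_cball.
by move=> x /negP; rewrite /cball /= subr0 -ltNge; exact: fr.
Qed.

Lemma cball_test (f : V -> C) rho : smooth_on setT f ->
  (forall x, rho < `|x| -> f x = 0) -> test setT f.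
Proof.
move=> sf fr; split => //.
apply: (subclosed_compact _ (@compact_cball _ _ 0 rho)); last exact: cball_supp.
exact: closed_closure.
Qed.

Lemma vanishes_outside_re (f : V -> C) rho : (forall x, rho < `|x| -> f x = 0) ->
  vanishes_outside rho (re f).
Proof. by move=> fr x /fr; rewrite /re => ->. Qed.

Lemma vanishes_outside_im (f : V -> C) rho : (forall x, rho < `|x| -> f x = 0) ->
  vanishes_outside rho (im f).
Proof. by move=> fr x /fr; rewrite /im => ->. Qed.

Section Slices.
Variables (T : set (V -> C)) (O : set V).

Lemma slice_in (F : pairs T O -> C) phi x (h : pairs T O (phi, x)) :
  slice F phi x = F (SigSub (mem_set h)).
Proof.
rewrite /slice /= oinv_set_val insubT /=; first exact: mem_set.
by move=> p; congr F; apply: val_inj.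
Qed.

Lemma slice_out (F : pairs T O -> C) phi x : ~ pairs T O (phi, x) ->
  slice F phi x = 0.
Proof. by move=> h; rewrite /slice /= oinv_set_val insubN //; apply/negP; rewrite inE. Qed.

Lemma open_pairs phi : open O -> compact (supp phi) ->
  open [set x | pairs T O (phi, x)].
Proof.
move=> oO cphi; rewrite openE => x [/= Tphi Ox sO].
have cs : compact (shifted_supp x phi).
  apply: continuous_compact => //; apply: continuous_subspaceT.
  exact: addl_continuous.
have [d d0 dO] := compact_thickening cs oO sO.
have nx : \forall y \near x, `|y - x| < d.
  by apply: filterS (nbhsx_ballx x _ d0) => y; rewrite -ball_normE /ball_ /= distrC.
have nO : \forall y \near x, O y by exact: open_nbhs_nbhs.
apply: filterS2 nx nO => y yd Oy; split => // _ [z sz <-].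
have -> : y + z = x + z + (y - x) by rewrite addrAC [x + _]addrC subrK.
by apply: dO; [exists z|exact: ltW].
Qed.

End Slices.

Lemma slice_restrict_e (O : set V) (F : Uc O -> C) phi : moments 0 phi ->
  slice (restrict_e F) phi = slice F phi.
Proof.
move=> mphi; apply/funext => x.
have [h|h] := pselect (Ue O (phi, x)).
  have h' : Uc O (phi, x) := Ue_sub_Uc h.
  rewrite (slice_in _ h) (slice_in _ h') /restrict_e /=.
  by congr F; apply: val_inj.
rewrite slice_out // slice_out // => -[/= Tphi Ox sO]; apply: h.
by split.
Qed.

Lemma pairs_moments (O : set V) phi x : moments 0 phi ->
  Uc O (phi, x) <-> Ue O (phi, x).
Proof. by move=> mphi; split => [[_ ? ?]|/Ue_sub_Uc//]; split. Qed.

Lemma restrict_e_smooth (O : set V) (F : Uc O -> C) : Bc F -> Ee (restrict_e F).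
Proof.
move=> BF phi mphi; rewrite slice_restrict_e //.
have -> : [set x | pairs (moments 0) O (phi, x)] = [set x | Uc O (phi, x)].
  by apply/seteqP; split => x /=; rewrite pairs_moments.
by apply: BF; case: mphi.
Qed.

Section Scaling.
Variables (eps : R) (eps0 : 0 < eps).
Implicit Types phi : V -> C.

Lemma re_scale phi : re (scale_test eps phi) = fun x => eps ^- n * re phi (eps^-1 *: x).
Proof. by apply/funext => x; rewrite /re /scale_test Re_realM. Qed.

Lemma im_scale phi : im (scale_test eps phi) = fun x => eps ^- n * im phi (eps^-1 *: x).
Proof. by apply/funext => x; rewrite /im /scale_test Im_realM. Qed.

Lemma dword_re_dilation (g : V -> R) w x : smooth_on_re setT g ->
  dword_re w (fun x => eps ^- n * g (eps^-1 *: x)) x =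
  eps ^- (n + size w) * dword_re w g (eps^-1 *: x).
Proof.
move=> sg; have sa := smooth_affine eps^-1 0 sg.
have E := dword_re_affine eps^-1 0 w sg x.
rewrite addr0 in E.
have Ef : (fun x : V => g (eps^-1 *: x + 0)) = fun x => g (eps^-1 *: x).
  by apply/funext => y; rewrite addr0.
rewrite Ef in sa E.
rewrite (@dword_reZ _ _ setT _ (eps ^- n) w openT sa x I) E mulrA; congr (_ * _).
by rewrite exprD invfM exprVn.
Qed.

Lemma scale_off rho (phi : V -> C) : (forall x, rho < `|x| -> phi x = 0) ->
  forall x, eps * rho < `|x| -> scale_test eps phi x = 0.
Proof.
move=> pr x xr; rewrite /scale_test pr ?mulr0 // normrZ.
by rewrite ger0_norm ?invr_ge0 ?ltW // ltr_pdivlMl.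
Qed.

Lemma scale_smooth phi : smooth_on setT phi -> smooth_on setT (scale_test eps phi).
Proof.
move=> [sr si]; split.
  by have := smooth_dilation (eps ^- n) eps^-1 sr; rewrite -re_scale.
by have := smooth_dilation (eps ^- n) eps^-1 si; rewrite -im_scale.
Qed.

Lemma scale_testP phi : test setT phi -> test setT (scale_test eps phi).
Proof.
move=> tphi; have [rho _ pr] := test_cball tphi.
by apply: (cball_test (scale_smooth _) (scale_off pr)); case: tphi.
Qed.

Lemma integral_scale phi : test setT phi ->
  integral_rV (scale_test eps phi) = integral_rV phi.
Proof.
move=> tphi; have [rho _ pr] := test_cball tphi; have [[sr si] _ _] := tphi.
have H (g : V -> R) : smooth_on_re setT g -> vanishes_outside rho g ->
    intV (fun x => eps ^- n * g (eps^-1 *: x)) = intV g.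
  move=> sg gr.
  have Cg : Cc rho g by exact: (Cc_smooth [::]).
  have ei : 0 < eps^-1 by rewrite invr_gt0.
  rewrite [RHS](intV_change 0 ei Cg) exprVn.
  have Ef : (fun x : V => g (eps^-1 *: x + 0)) = fun x => g (eps^-1 *: x).
    by apply/funext => y; rewrite addr0.
  rewrite Ef; apply: (@intV_scale _ _ (eps * rho)); split.
    by rewrite -Ef; exact: continuous_comp_affine Cg.1.
  move=> x xr; apply: gr; rewrite normrZ ger0_norm ?invr_ge0 ?ltW //.
  by rewrite ltr_pdivlMl.
rewrite !integral_rVE; apply: complex_ext => /=.
  by rewrite -[RHS](H _ sr (vanishes_outside_re pr)) -re_scale.
by rewrite -[RHS](H _ si (vanishes_outside_im pr)) -im_scale.
Qed.

Lemma moments_scale0 phi : moments 0 phi -> moments 0 (scale_test eps phi).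
Proof.
move=> [tphi iphi _]; split; [exact: scale_testP|by rewrite integral_scale|].
by move=> a; case: (mdeg a).
Qed.

End Scaling.

Implicit Types phi : V -> C.

Lemma moments_le k k' phi : (k <= k')%N -> moments k' phi -> moments k phi.
Proof.
move=> kk [t i m]; split => // a /andP[a1 ak]; apply: m.
by rewrite a1 (leq_trans ak).
Qed.

Lemma test_words_bounded m phi : test setT phi -> exists2 M : R, 0 <= M &
  forall w, (size w <= m)%N -> forall x,
    `|dword_re w (re phi) x| <= M /\ `|dword_re w (im phi) x| <= M.
Proof.
move=> tphi; have [rho rho0 pr] := test_cball tphi; have [[sr si] _ _] := tphi.
have bnd (g : V -> R) : smooth_on_re setT g -> vanishes_outside rho g ->
    exists2 M : R, 0 <= M & forall w, (size w <= m)%N -> forall x, `|dword_re w g x| <= M.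
  move=> sg gr; have [//|M M0 HM] := smooth_words_bounded m sg (@compact_cball _ _ 0 rho).
  exists M => // w wc x; have [xr|xr] := leP `|x| rho.
    by apply: HM => //; rewrite /cball /= subr0.
  by rewrite (vanishes_outside_dword _ gr) // normr0.
have [M M0 HM] := bnd _ sr (vanishes_outside_re pr).
have [N N0 HN] := bnd _ si (vanishes_outside_im pr).
exists (M + N); first exact: addr_ge0.
by move=> w wm x; rewrite (le_trans (HM _ wm _)) ?lerDl // (le_trans (HN _ wm _)) ?lerDr.
Qed.

(** Scaling brings out a factor eps^-n, and every derivative another eps^-1. *)
Lemma tnorm_scale c phi : test setT phi -> exists2 M : R, 0 <= M &
  forall eps : R, 0 < eps <= 1 -> tnorm c (scale_test eps phi) <= M * eps ^- (n + c).
Proof.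
move=> tphi; have [[sr si] _ _] := tphi.
have [M M0 HM] := test_words_bounded c tphi.
exists (M + M); first exact: addr_ge0.
move=> eps /andP[eps0 eps1].
have ep : 0 <= eps ^- (n + c) by rewrite invr_ge0 exprn_ge0 // ltW.
apply: seminorm_le => [|x a _ ac]; first by rewrite mulr_ge0 // addr_ge0.
rewrite (le_trans (absc_le_ReIm _)) // dpartial_re dpartial_im.
rewrite re_scale im_scale (dword_re_dilation _ _ _ sr) (dword_re_dilation _ _ _ si).
rewrite size_word_of mulrDl.
have ea : eps ^- (n + mdeg a) <= eps ^- (n + c).
  rewrite lef_pV2 ?posrE ?exprn_gt0 // ler_wiXn2l // ?leq_add2l //; exact: ltW.
have ea0 : 0 <= eps ^- (n + mdeg a) by rewrite invr_ge0 exprn_ge0 // ltW.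
have [|h1 h2] := HM (word_of a) _ (eps^-1 *: x); first by rewrite size_word_of.
rewrite !normrM !(ger0_norm ea0) ![_ * eps ^- _]mulrC.
by rewrite lerD // ler_pM.
Qed.

End ComplexLayer.

(** * Moderate and negligible elements *)

Section Estimates.
Local Open Scope complex_scope.
Variables (R : realType) (n : nat).
Local Notation V := 'rV[R]_n.
Local Notation C := R[i].
Implicit Types phi : V -> C.

(** The exponent J is independent of c, which depends on the test function: the
    order of the moment conditions has to be fixed before phi is chosen. *)
Lemma P0_growth (p : {poly R}) : P0 p -> exists J : nat, forall c : R, 0 <= c ->
  exists2 c' : R, 0 <= c' & forall (e y : R) (k : nat), 0 < e <= 1 ->
    0 <= y <= c * e ^- k -> p.[y] <= c' * e ^- (k * J).
Proof.
move=> p0; exists (size p) => c c0.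
exists (\sum_(i < size p) p`_i * c ^+ i).
  by rewrite sumr_ge0 // => i _; rewrite mulr_ge0 ?exprn_ge0 //; exact: p0.
move=> e y k /andP[e0 e1] /andP[y0 yc]; rewrite horner_coef mulr_suml.
apply: ler_sum => i _; rewrite -mulrA ler_wpM2l //.
rewrite (@le_trans _ _ ((c * e ^- k) ^+ i)) ?lerXn2r ?nnegrE // ?(le_trans y0) //.
rewrite exprMn ler_wpM2l ?exprn_ge0 // exprVn -exprM.
rewrite lef_pV2 ?posrE ?exprn_gt0 // ler_wiXn2l // ?(ltW e0) //.
by rewrite leq_mul2l (ltnW (ltn_ord i)) orbT.
Qed.

(** Every monomial of an element of I0 contains the second variable, so a small
    second argument makes up for a polynomially large first one. *)
Lemma I0_growth (p : {poly {poly R}}) : I0 p -> exists J : nat, forall c : R, 0 <= c ->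
  exists2 c' : R, 0 <= c' & forall (e y z : R) (k b : nat), 0 < e <= 1 ->
    0 <= y <= c * e ^- k -> 0 <= z <= c * e ^+ b ->
    eval2 p y z <= c' * (e ^+ b * e ^- (k * J)).
Proof.
move=> [p0 pz]; have /choice[J HJ] := fun i => P0_growth (p0 i).
pose JJ := (\max_(i < size p) J i)%N; exists JJ => c c0.
have /choice[c' Hc'] : forall i, exists c' : R, 0 <= c' /\
  forall (e y : R) (k : nat), 0 < e <= 1 -> 0 <= y <= c * e ^- k ->
    (p`_i).[y] <= c' * e ^- (k * J i).
  by move=> i; have [c' ? ?] := HJ i c c0; exists c'.
exists (\sum_(i < size p) c' i * c ^+ i).
  by rewrite sumr_ge0 // => i _; rewrite mulr_ge0 ?exprn_ge0 //; have [] := Hc' i.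
move=> e y z k b e01 yc /andP[z0 zc]; have /andP[e0 e1] := e01.
have e0' := ltW e0.
have pp i : 0 <= (p`_i).[y].
  rewrite horner_coef sumr_ge0 // => j _; rewrite mulr_ge0 ?exprn_ge0 //.
  by case/andP: yc.
rewrite /eval2 [p.[_]]horner_coef horner_sum mulr_suml; apply: ler_sum => i _.
rewrite -polyC_exp hornerM hornerC.
have [i0|i0] := posnP (i : nat).
  rewrite i0; move: pz; rewrite horner_coef0 => ->; rewrite horner0 mul0r.
  rewrite !mulr_ge0 ?exprn_ge0 ?invr_ge0 ?exprn_ge0 //.
  by have [] := Hc' 0%N.
have [c'0 /(_ e y k e01 yc) pc] := Hc' i.
have eJ : e ^- (k * J i) <= e ^- (k * JJ).
  rewrite lef_pV2 ?posrE ?exprn_gt0 // ler_wiXn2l // leq_mul2l.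
  by rewrite (leq_bigmax_cond (F := fun i : 'I_(size p) => J i)) ?orbT.
have zi : z ^+ i <= c ^+ i * e ^+ b.
  rewrite (@le_trans _ _ ((c * e ^+ b) ^+ i)) ?lerXn2r ?nnegrE // ?(le_trans z0) //.
  rewrite exprMn ler_wpM2l ?exprn_ge0 // -exprM ler_wiXn2l //.
  by rewrite leq_pmulr.
apply: (@le_trans _ _ ((c' i * e ^- (k * JJ)) * (c ^+ i * e ^+ b))).
  rewrite ler_pM ?exprn_ge0 // (le_trans pc) // ler_wpM2l //.
by rewrite le_eqVlt; apply/orP; left; apply/eqP; ring.
Qed.

Lemma star_delta_norm_ge0 K c (B : set (V -> C)) phi : 0 <= star_delta_norm K c B phi.
Proof. by apply: sup_ge0 => r [x [a [f [_ _ _ ->]]]]; exact: absc_ge0. Qed.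

Lemma cball_trans (x y : V) (r s : R) : cball x r y -> cball y s `<=` cball x (r + s).
Proof.
rewrite /cball /= => xy z /= zy.
by rewrite (le_trans (ler_distD y z x)) // addrC lerD.
Qed.

Lemma cball_compactly_in (x : V) (r : R) (U : set V) : open U -> cball x r `<=` U ->
  compactly_in (cball x r) U.
Proof. by move=> oU xU; split; [exact: compact_cball|rewrite ((interior_id U).1 oU)]. Qed.

Lemma cball_compactly_in_cball (x : V) (r s : R) : r < s -> compactly_in (cball x r) (cball x s).
Proof.
move=> rs; split; first exact: compact_cball.
move=> y xy; have sr : 0 < s - r by rewrite subr_gt0.
apply: filterS (nbhsx_ballx y _ sr) => z.
rewrite -ball_normE /ball_ /= distrC => /ltW zy.
by have := cball_trans xy zy; rewrite addrC subrK.
Qed.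

Lemma bounded_smooth_words (U K : set V) (B : set (V -> C)) m : open U ->
  bounded_smooth U B -> compactly_in K U ->
  exists2 A : R, 0 <= A & forall f, B f -> forall w, (size w <= m)%N -> forall y, K y ->
    `|dword_re w (re f) y| <= A /\ `|dword_re w (im f) y| <= A.
Proof.
move=> oU [BU Bb] KU; have [M HM] := Bb K m KU.
(* If B is empty, M may be negative. *)
exists (Num.max 0 M); first by rewrite le_max lexx.
move=> f Bf w wm y Ky; have [cK KU'] := KU; rewrite ((interior_id U).1 oU) in KU'.
have [sr si] := BU f Bf.
have := smooth_seminorm_ge (BU f Bf) cK KU' (a := [ffun i => count_mem i w]) Ky (m := m).
rewrite mdeg_count => /(_ wm) H.
have {}H : absc (dpartial [ffun i => count_mem i w] f y) <= Num.max 0 M.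
  by rewrite le_max (le_trans H (HM f Bf)) orbT.
have Uy := KU' _ Ky; split.
  rewrite (dword_re_perm oU sr (perm_word_of w) Uy) -dpartial_re.
  exact: le_trans (Re_le_absc _) H.
rewrite (dword_re_perm oU si (perm_word_of w) Uy) -dpartial_im.
exact: le_trans (Im_le_absc _) H.
Qed.

(** The real and imaginary parts of the integrand are combinations of four real
    products, to which [kernel_approx] applies.  As re phi has integral 1 and
    im phi has integral 0, only the products with re phi leave a main term. *)
Lemma star_delta_scale q c phi (U : set V) (B : set (V -> C)) (x0 : V) (r : R) :
  moments q phi -> open U -> bounded_smooth U B -> 0 < r -> cball x0 (r + r) `<=` U ->
  exists (M e0 : R), [/\ 0 <= M, 0 < e0 & forall e, 0 < e <= e0 ->
    star_delta_norm (cball x0 r) c B (scale_test e phi) <= M * e ^+ q.+1].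
Proof.
move=> [tphi iphi mphi] oU bB r0 x0U.
have [rho rho0 pr] := test_cball tphi; have [[sr si] _ _] := tphi.
have mre a : (1 <= mdeg a <= q)%N -> intV (fun z => mono a z * re phi z) = 0.
  move=> /mphi; rewrite integral_rVE => -[<- _]; congr intV.
  by apply/funext => z; rewrite Re_realM.
have mim a : (1 <= mdeg a <= q)%N -> intV (fun z => mono a z * im phi z) = 0.
  move=> /mphi; rewrite integral_rVE => -[_ <-]; congr intV.
  by apply/funext => z; rewrite Im_realM.
have [i1 i0] : intV (re phi) = 1 /\ intV (im phi) = 0.
  by move: iphi; rewrite integral_rVE => -[].
have [C1 C10 H1] := kernel_approx sr (ltW rho0) (vanishes_outside_re pr) mre.
have [C2 C20 H2] := kernel_approx si (ltW rho0) (vanishes_outside_im pr) mim.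
have [A A0 HA] := bounded_smooth_words (q.+1 + c) oU bB (cball_compactly_in oU x0U).
exists ((C1 + C2) * A + (C1 + C2) * A), (r / rho).
split; [by rewrite addr_ge0 ?mulr_ge0 ?addr_ge0|by rewrite divr_gt0|].
move=> e /andP[e0 er].
have er' : e * rho <= r by rewrite -ler_pdivlMr.
have ee : 0 <= e ^+ q.+1 by rewrite exprn_ge0 // ltW.
apply: sup_le_ub; first by rewrite mulr_ge0 ?addr_ge0 ?mulr_ge0 ?addr_ge0.
move=> _ [x [a [f [Kx ac Bf ->]]]].
have [sf1 sf2] := bB.1 f Bf.
pose w := word_of a; have sw : size w = mdeg a by exact: size_word_of.
have xer : cball x (e * rho) `<=` cball x0 (r + r).
  by apply: subset_trans (cball_trans Kx); exact: cball_le.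
have xU : cball x (e * rho) `<=` U by exact: subset_trans x0U.
have words_re w' y : size w' = q.+1 -> cball x (e * rho) y ->
    `|dword_re w' (dword_re w (re f)) y| <= A /\
    `|dword_re w' (dword_re w (im f)) y| <= A.
  move=> sw' xy; rewrite -!dword_re_cat; apply: HA => //; last exact: xer.
  by rewrite size_cat sw' sw leq_add2l.
pose P y := dword_re w (fun x' => e ^- n * re phi (e^-1 *: (y - x'))) x.
pose Q y := dword_re w (fun x' => e ^- n * im phi (e^-1 *: (y - x'))) x.
have [CRP BRP] := H1 U (re f) w e A x oU sf1 e0 A0 xU (fun w' s y h => (words_re w' y s h).1).
have [CIP BIP] := H1 U (im f) w e A x oU sf2 e0 A0 xU (fun w' s y h => (words_re w' y s h).2).
have [CRQ BRQ] := H2 U (re f) w e A x oU sf1 e0 A0 xU (fun w' s y h => (words_re w' y s h).1).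
have [CIQ BIQ] := H2 U (im f) w e A x oU sf2 e0 A0 xU (fun w' s y h => (words_re w' y s h).2).
have dP y : complex.Re (dpartial a (fun x' => scale_test e phi (y - x')) x) = P y.
  by rewrite dpartial_re; congr (dword_re w _ x); apply/funext => x'; exact: Re_realM.
have dQ y : complex.Im (dpartial a (fun x' => scale_test e phi (y - x')) x) = Q y.
  by rewrite dpartial_im; congr (dword_re w _ x); apply/funext => x'; exact: Im_realM.
set I := integral_rV _.
have IE : I = Complex (intV (fun y => re f y * P y) - intV (fun y => im f y * Q y))
                      (intV (fun y => re f y * Q y) + intV (fun y => im f y * P y)).
  rewrite /I integral_rVE; congr Complex.
    rewrite -mulN1r -(intV_scale _ CIQ) -(intV_add CRP (CcZ (-1) CIQ)); congr intV.
    by apply/funext => y; rewrite complexReM dP dQ mulN1r.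
  rewrite -(intV_add CRQ CIP); congr intV.
  by apply/funext => y; rewrite complexImM dP dQ.
have ineq (a1 a2 b d u v : R) : `|a1 - 1 * b| <= u -> `|a2 - 0 * d| <= v ->
    `|a1 - a2 - b| <= u + v /\ `|a2 + a1 - b| <= u + v.
  rewrite mul1r mul0r subr0 => h1 h2; split.
    by rewrite addrAC (le_trans (ler_normB _ _)) // lerD.
  by rewrite -addrA addrC (le_trans (ler_normD _ _)) // lerD.
move: BRP BIP BRQ BIQ; rewrite -/(re phi) -/(im phi) i1 i0 => BRP BIP BRQ BIQ.
rewrite (le_trans (absc_le_ReIm _)) // [leRHS]mulrDl lerD //.
  rewrite IE.
  have := (ineq _ _ _ _ _ _ BRP BIQ).1; rewrite -mulrDl mulrA.
  by case: (dpartial a f x) (dpartial_re a f x) => u v /= ->.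
rewrite IE.
have := (ineq _ _ _ _ _ _ BIP BRQ).2; rewrite -mulrDl mulrA.
by case: (dpartial a f x) (dpartial_im a f x) => u v /= ->.
Qed.


(** The asymptotic conditions in terms of the derivatives at single points: in
    this form they pass to finite unions, whereas the seminorm of a union need not
    be bounded by the seminorms of the parts when a supremum is infinite. *)
Definition pointwise_rate (O : set V) (F : Uc O -> C) (m : nat) (rate : R -> R)
    (phi : V -> C) (A : set V) :=
  exists M : R, \forall e \near (0 : R)^'+, forall x a, A x -> (mdeg a <= m)%N ->
    absc (dpartial a (slice F (scale_test e phi)) x) <= M * rate e.

Lemma pointwise_rate_global (O : set V) (F : Uc O -> C) m (rate : nat -> R -> R)
    (K : set V) : (forall q e, 0 < e -> 0 <= rate q e) -> compact K ->
  (forall x, K x -> exists2 r : R, 0 < r & exists q0, forall q, (q0 <= q)%N ->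
     forall phi, moments q phi -> pointwise_rate F m (rate q) phi (cball x r)) ->
  exists q0, forall q, (q0 <= q)%N ->
     forall phi, moments q phi -> pointwise_rate F m (rate q) phi K.
Proof.
move=> rate0 cK.
pose P A := exists q0, forall q, (q0 <= q)%N ->
     forall phi, moments q phi -> pointwise_rate F m (rate q) phi A.
apply: (compact_local_to_global (P := P) cK).
- by exists 0%N => q _ phi _; exists 0; apply: nearW.
- move=> A B AB [q0 H]; exists q0 => q q0q phi mphi; have [M HM] := H q q0q phi mphi.
  by exists M; apply: filterS HM => e He x a /AB; exact: He.
- move=> A B [q1 H1] [q2 H2]; exists (maxn q1 q2) => q; rewrite geq_max => /andP[q1q q2q].
  move=> phi mphi; have [M HM] := H1 q q1q phi mphi; have [N HN] := H2 q q2q phi mphi.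
  exists (Num.max M N); near=> e.
  have e0 : 0 < e by near: e; exact: nbhs_right_gt.
  move=> x a [Ax|Bx] am.
    have HMe : forall x a, A x -> (mdeg a <= m)%N ->
      absc (dpartial a (slice F (scale_test e phi)) x) <= M * rate q e by near: e.
    by rewrite (le_trans (HMe x a Ax am)) // ler_wpM2r ?rate0 // le_max lexx.
  have HNe : forall x a, B x -> (mdeg a <= m)%N ->
    absc (dpartial a (slice F (scale_test e phi)) x) <= N * rate q e by near: e.
  by rewrite (le_trans (HNe x a Bx am)) // ler_wpM2r ?rate0 // le_max lexx orbT.
Unshelve. all: by end_near. Qed.

Lemma pointwise_rate_bigO (O K : set V) (F : Uc O -> C) m (rate : R -> R) phi :
  (forall e, 0 < e -> 0 <= rate e) -> moments 0 phi -> pointwise_rate F m rate phi K ->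
  (fun e : R => seminorm K m (slice (restrict_e F) (scale_test e phi))) =O_ (0^'+) rate.
Proof.
move=> rate0 mphi [M HM]; apply/eqO_exP; exists (Num.max 1 M); first by rewrite lt_max ltr01.
near=> e.
have e0 : 0 < e by near: e; exact: nbhs_right_gt.
have re0 := rate0 e e0.
rewrite slice_restrict_e; last exact: moments_scale0.
rewrite !ger0_norm //; last exact: seminorm_ge0.
apply: seminorm_le; first by rewrite mulr_ge0 // le_max ler01.
move=> x a Kx am.
have HMe : forall x a, K x -> (mdeg a <= m)%N ->
    absc (dpartial a (slice F (scale_test e phi)) x) <= M * rate e by near: e.
by rewrite (le_trans (HMe x a Kx am)) // ler_wpM2r // le_max lexx orbT.
Unshelve. all: by end_near. Qed.

Lemma open_cball (U : set V) x : open U -> U x ->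
  exists2 r : R, 0 < r & cball x (r + r) `<=` U.
Proof.
move=> oU Ux; have [r r0 rU] := near_norm (open_nbhs_nbhs (conj oU Ux)).
exists (r / 3); first by rewrite divr_gt0.
by move=> y; rewrite /cball /= => yx; apply: rU; rewrite (le_lt_trans yx) //; lra.
Qed.

(** For small e the supports stay in the larger ball, where slices are smooth;
    this makes their seminorms on the smaller ball finite. *)
Lemma slice_scale_bound (O U : set V) (F : Uc O -> C) m (x : V) (r rho e : R) phi :
  open O -> U `<=` O -> Bc F -> 0 < r -> cball x (r + r) `<=` U -> 0 < e -> test setT phi ->
  (forall y, rho < `|y| -> phi y = 0) -> e * rho <= r ->
  [set y + z | y in cball x r & z in supp (scale_test e phi)] `<=` cball x (r + r) /\
  forall y a, cball x r y -> (mdeg a <= m)%N ->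
    absc (dpartial a (slice F (scale_test e phi)) y) <=
    seminorm (cball x r) m (slice F (scale_test e phi)).
Proof.
move=> oO UO BF r0 xU e0 tphi pr er.
have te : test setT (scale_test e phi) by exact: scale_testP.
have se := cball_supp (scale_off e0 pr).
have sub : [set y + z | y in cball x r & z in supp (scale_test e phi)]
    `<=` cball x (r + r).
  move=> _ [y xy [z sz <-]]; have := se z sz; rewrite {1}/cball /= subr0 => zr.
  by apply: (cball_trans xy); rewrite /cball /= addrC addKr (le_trans zr).
split => // y a xy am.
have oW : open [set y | Uc O (scale_test e phi, y)].
  by apply: open_pairs => //; case: te.
apply: (smooth_seminorm_ge (BF _ te) (@compact_cball _ _ x r)) => // z xz.
split => //=.
  by apply: UO; apply: xU; apply: (cball_trans xz); rewrite /cball /= subrr normr0 ltW.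
by move=> _ [t st <-]; apply: UO; apply: xU; apply: sub; exists z => //; exists t.
Qed.

Lemma near0_scale (r rho : R) : 0 < r -> 0 < rho ->
  \forall e \near (0 : R)^'+, [/\ 0 < e, e <= 1 & e * rho <= r].
Proof.
move=> r0 rho0; near=> e; split.
- by near: e; exact: nbhs_right_gt.
- by near: e; exact: nbhs_right_le.
- by rewrite -ler_pdivlMr //; near: e; apply: nbhs_right_le; rewrite divr_gt0.
Unshelve. all: by end_near. Qed.

(** Near each point the exponent (n + c) * J bounds the growth of the polynomial;
    finitely many points suffice for a compact set. *)
Lemma Mc_restrict (O : set V) (F : Uc O -> C) : open O -> Mc F -> EeM (restrict_e F).
Proof.
move=> oO [BF MF]; split; first exact: restrict_e_smooth.
move=> K [cK KO] m; rewrite ((interior_id O).1 oO) in KO.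
have rate0 (q : nat) (e : R) : 0 < e -> 0 <= e ^- q.
  by move=> e0; rewrite invr_ge0 exprn_ge0 // ltW.
have [x Kx|q0 H] := pointwise_rate_global (F := F) (m := m) rate0 cK.
  have [U [oU Ux UO HU]] := MF x (KO x Kx).
  have [r r0 xU] := open_cball oU Ux; exists r => //.
  have xU1 : cball x r `<=` U by apply: subset_trans xU; apply: cball_le; rewrite lerDl ltW.
  have rr : r < r + r by rewrite ltrDl.
  have [c [p [P0p Hp]]] := HU _ _ (cball_compactly_in oU xU1) (cball_compactly_in oU xU)
    (cball_compactly_in_cball x rr) m.
  have [J HJ] := P0_growth P0p.
  exists ((n + c) * J)%N => q q0q phi [tphi _ _].
  have [rho rho0 pr] := test_cball tphi.
  have [M M0 HM] := tnorm_scale c tphi; have [M' M'0 HM'] := HJ M M0.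
  exists M'; apply: filterS (near0_scale r0 rho0) => e [e0 e1 er].
  have e01 : 0 < e <= 1 by rewrite e0.
  have [sub bnd] := slice_scale_bound m oO UO BF r0 xU e0 tphi pr er.
  move=> y a xy am; apply: (le_trans (bnd y a xy am)).
  apply: (le_trans (Hp _ (scale_testP e0 tphi) sub)).
  apply: (le_trans (HM' e _ (n + c)%N e01 _)).
    by rewrite seminorm_ge0 HM.
  rewrite ler_wpM2l // lef_pV2 ?posrE ?exprn_gt0 // ler_wiXn2l //; exact: ltW.
(* The definition asks for a positive number. *)
exists q0.+1 => // phi mphi; apply: pointwise_rate_bigO.
- by move=> e; exact: rate0.
- exact: moments_le mphi.
- exact: H.
Qed.

(** The order q of the moment conditions is chosen so large that the factor
    e^(q+1) of [star_delta_scale] beats the growth of the norms. *)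
Lemma Nc_restrict (O : set V) (F : Uc O -> C) : open O -> Nc F -> Ne (restrict_e F).
Proof.
move=> oO [BF NF]; split; first exact: restrict_e_smooth.
move=> K [cK KO] m N N0; rewrite ((interior_id O).1 oO) in KO.
have rate0 (q : nat) (e : R) : 0 < e -> 0 <= e ^+ N.
  by move=> e0; rewrite exprn_ge0 // ltW.
have [x Kx|q0 H] := pointwise_rate_global (F := F) (m := m) rate0 cK.
  have [U [oU Ux UO HU]] := NF x (KO x Kx).
  have [r r0 xU] := open_cball oU Ux; exists r => //.
  have xU1 : cball x r `<=` U by apply: subset_trans xU; apply: cball_le; rewrite lerDl ltW.
  have rr : r < r + r by rewrite ltrDl.
  have [c [p [B [I0p bB Hp]]]] := HU _ _ (cball_compactly_in oU xU1)
    (cball_compactly_in oU xU) (cball_compactly_in_cball x rr) m.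
  have [J HJ] := I0_growth I0p.
  exists (N + (n + c) * J)%N => q q0q phi mphi; have [tphi _ _] := mphi.
  have [rho rho0 pr] := test_cball tphi.
  have [M M0 HM] := tnorm_scale c tphi.
  have [M1 [e1' [M10 e1'0 HM1]]] := star_delta_scale c mphi oU bB r0 xU.
  have [M' M'0 HM'] := HJ _ (addr_ge0 M0 M10).
  exists M'; near=> e.
  have [e0 e1 er] : [/\ 0 < e, e <= 1 & e * rho <= r].
    by near: e; exact: near0_scale.
  have ee1 : e <= e1' by near: e; exact: nbhs_right_le.
  have e01 : 0 < e <= 1 by rewrite e0.
  have [sub bnd] := slice_scale_bound m oO UO BF r0 xU e0 tphi pr er.
  move=> y a xy am; apply: (le_trans (bnd y a xy am)).
  apply: (le_trans (Hp _ (scale_testP e0 tphi) sub)).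
  have ek : 0 <= e ^- (n + c) by rewrite invr_ge0 exprn_ge0 // ltW.
  have eq : 0 <= e ^+ q.+1 by rewrite exprn_ge0 // ltW.
  apply: (le_trans (HM' e _ _ (n + c)%N q.+1 e01 _ _)).
  - by rewrite seminorm_ge0 (le_trans (HM e e01)) // ler_wpM2r // lerDl.
  - rewrite star_delta_norm_ge0 (le_trans (HM1 e _)) ?e0 //.
    by rewrite ler_wpM2r // lerDr.
  - rewrite ler_wpM2l // ler_pdivrMr ?exprn_gt0 // -exprD ler_wiXn2l ?(ltW e0) //.
    exact: leqW.
(* The definition asks for a positive number. *)
exists q0.+1 => // phi mphi; apply: pointwise_rate_bigO.
- by move=> e; exact: (rate0 0%N).
- exact: moments_le mphi.
- exact: (H q0.+1).
Unshelve. all: by end_near. Qed.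

End Estimates.

(** * The embeddings of smooth functions and of distributions *)

Section Embeddings.
Local Open Scope complex_scope.
Variables (R : realType) (n : nat) (O : set 'rV[R]_n).
Hypothesis oO : open O.
Local Notation V := 'rV[R]_n.
Local Notation C := R[i].
Local Notation d_ i := (delta_mx 0 i : V).
Implicit Types phi psi f g : V -> C.

Lemma sigma_c_smooth f : smooth_on O f -> Bc (sigma_c O f).
Proof.
move=> [sr si] phi tphi.
have oW : open [set x | pairs (test setT) O (phi, x)].
  by apply: open_pairs => //; case: tphi.
have E x : pairs (test setT) O (phi, x) -> f x = slice (sigma_c O f) phi x.
  by move=> h; rewrite (slice_in _ h).
have WO : [set x | pairs (test setT) O (phi, x)] `<=` O by move=> x [].
split.
  apply: (@smooth_local _ _ _ (re f)) => //; last exact: smooth_subset sr.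
  by move=> x /E; rewrite /re => ->.
apply: (@smooth_local _ _ _ (im f)) => //; last exact: smooth_subset si.
by move=> x /E; rewrite /im => ->.
Qed.

Lemma restrict_sigma f : restrict_e (sigma_c O f) = sigma_e O f.
Proof. by []. Qed.

Lemma restrict_iota (u : test O -> C) : restrict_e (iota_c u) = iota_e u.
Proof. by apply/funext => p; congr u; apply: val_inj. Qed.

Lemma supp_dword phi w : supp (dword w phi) `<=` supp phi.
Proof.
apply: supp_sub; first exact: closed_closure.
have cs : closed (supp phi) by exact: closed_closure.
move=> x sx; apply: complex_ext => /=.
  by apply: (vanishes_off_dword cs w _ sx) => y /supp_off; rewrite /re => ->.
by apply: (vanishes_off_dword cs w _ sx) => y /supp_off; rewrite /im => ->.
Qed.

Lemma smooth_on_dword (U : set V) phi w : smooth_on U phi -> smooth_on U (dword w phi).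
Proof. by move=> [sr si]; split; [exact: (smooth_dword w sr)|exact: (smooth_dword w si)]. Qed.

Lemma test_dword phi w : test setT phi -> test setT (dword w phi).
Proof.
move=> [sp cp _]; split; [exact: smooth_on_dword| |by []].
by apply: (subclosed_compact _ cp (@supp_dword phi w)); exact: closed_closure.
Qed.

Lemma pairs_dword phi w x : Uc O (phi, x) -> Uc O (dword w phi, x).
Proof.
move=> [/= tp Ox sO]; split => //=; first exact: test_dword.
by move=> _ [z /supp_dword sz <-]; apply: sO; exists z.
Qed.

Definition real_comb (k : R) f g : V -> C := fun x => k%:C * f x + g x.

Lemma re_real_comb k f g : re (real_comb k f g) = fun x => k * re f x + re g x.
Proof.
apply/funext => x; rewrite /re /real_comb -Re_realM.
by case: (_ * _) (g x) => a b [].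
Qed.

Lemma im_real_comb k f g : im (real_comb k f g) = fun x => k * im f x + im g x.
Proof.
apply/funext => x; rewrite /im /real_comb -Im_realM.
by case: (_ * _) (g x) => a b [].
Qed.

Lemma smooth_real_comb k f g : smooth_on setT f -> smooth_on setT g ->
  smooth_on setT (real_comb k f g).
Proof.
move=> [fr fi] [gr gi]; split.
  by have := smooth_lin k openT fr gr; rewrite -re_real_comb.
by have := smooth_lin k openT fi gi; rewrite -im_real_comb.
Qed.

Lemma supp_real_comb k f g (K : set V) : closed K -> supp f `<=` K -> supp g `<=` K ->
  supp (real_comb k f g) `<=` K.
Proof.
move=> cK fK gK; apply: supp_sub => // x Kx; rewrite /real_comb !supp_off ?mulr0 ?addr0 //.
  by move/gK.
by move/fK.
Qed.

Lemma diffquot_le (a b D t B M : R) : t != 0 ->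
  `|b - (a + - t * D)| <= B * (`|t| ^+ 2 * M) ->
  `|t^-1 * (- a + b) + D| <= B * M * `|t|.
Proof.
move=> t0 h; rewrite (_ : t^-1 * (- a + b) + D = t^-1 * (b - (a + - t * D))); last first.
  by field.
have n0 : `|t| != 0 by rewrite normr_eq0.
rewrite normrM normfV (_ : B * M * `|t| = `|t|^-1 * (B * (`|t| ^+ 2 * M))).
  by rewrite ler_wpM2l // invr_ge0.
by field.
Qed.

Section Distribution.
Variables (u : test O -> C) (du : distribution u).

(** A total version of u spares the membership proofs for the test functions that
    are formed below. *)
Definition pairing (f : V -> C) : C := 'valL_(0 : C) u f.

Lemma pairing_in f (h : test O f) : pairing f = u (SigSub (mem_set h)).
Proof.
rewrite /pairing /= oinv_set_val insubT /=; first exact: mem_set.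
by move=> p; congr u; apply: val_inj.
Qed.

Lemma slice_iota phi x : Uc O (phi, x) ->
  slice (iota_c u) phi x = pairing (fun y => phi (y - x)).
Proof.
move=> h; have [/= tp _ sO] := h.
rewrite (slice_in _ h) (pairing_in (test_shift tp sO)) /iota_c.
by congr u; apply: val_inj.
Qed.

Lemma pairing_real_comb k f g : test O f -> test O g -> test O (real_comb k f g) ->
  pairing (real_comb k f g) = k%:C * pairing f + pairing g.
Proof.
by move=> tf tg tfg; rewrite (pairing_in tf) (pairing_in tg) (pairing_in tfg); apply: du.1.
Qed.

Lemma pairing_bound (K : set V) : compact K -> K `<=` O ->
  exists (M : R) (m : nat), 0 <= M /\ forall f, test O f -> supp f `<=` K ->
    absc (pairing f) <= M * tnorm m f.
Proof.
move=> cK KO; have [M [m HM]] := du.2 K cK KO.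
exists (Num.max 0 M), m; split; first by rewrite le_max lexx.
move=> f tf fK; rewrite (pairing_in tf) (le_trans (HM _ _)) //.
by rewrite ler_wpM2r ?seminorm_ge0 // le_max lexx orbT.
Qed.

Lemma compact_sumset (S : set V) (d : R) : compact S ->
  compact [set y + z | y in S & z in cball 0 d].
Proof.
move=> cS.
have -> : [set y + z | y in S & z in cball 0 d] =
   (fun p : V * V => p.1 + p.2) @` (S `*` cball 0 d).
  apply/seteqP; split => [_ [y Sy [z dz <-]]|_ [[y z] [/= Sy dz] <-]].
    by exists (y, z).
  by exists y => //; exists z.
apply: continuous_compact; last by apply: compact_setX => //; exact: compact_cball.
by apply: continuous_subspaceT => p; exact: add_continuous.
Qed.

(** All the translates phi(. - x - h), for small h, have their supports in one
    compact set, so that a single seminorm controls u on them. *)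
Lemma local_translates phi x : Uc O (phi, x) -> exists (d : R) (K : set V),
  [/\ 0 < d, compact K, K `<=` O & forall h, `|h| <= d ->
     Uc O (phi, x + h) /\ supp (fun y => phi (y - (x + h))) `<=` K].
Proof.
move=> [/= tp Ox sO].
have cs : compact (shifted_supp x phi).
  apply: continuous_compact; last by case: tp.
  by apply: continuous_subspaceT; exact: addl_continuous.
have [d1 d10 H1] := compact_thickening cs oO sO.
have [d2 d20 H2] : exists2 d : R, 0 < d & forall z, `|z| <= d -> O (x + z).
  have [||d d0 Hd] := @compact_thickening _ _ [set x] O _ oO; first exact: compact_set1.
    by move=> _ ->.
  by exists d => // z; exact: Hd.
exists (Num.min d1 d2), [set y + z | y in shifted_supp x phi & z in cball 0 d1].
have KO : [set y + z | y in shifted_supp x phi & z in cball 0 d1] `<=` O.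
  by move=> _ [y sy [z zd <-]]; apply: H1 => //; move: zd; rewrite /cball /= subr0.
split => //; first by rewrite lt_min d10.
  exact: compact_sumset.
move=> h; rewrite le_min => /andP[h1 h2].
have sK : shifted_supp (x + h) phi `<=`
    [set y + z | y in shifted_supp x phi & z in cball 0 d1].
  move=> _ [z sz <-]; exists (x + z); first by exists z.
  by exists h; [rewrite /cball /= subr0|rewrite addrAC].
split; last by rewrite supp_shift.
by split => //=; [exact: H2|exact: subset_trans sK KO].
Qed.

Lemma tnorm_le m f (M : R) : 0 <= M -> (forall w, (size w <= m)%N -> forall y,
    `|dword_re w (re f) y| <= M /\ `|dword_re w (im f) y| <= M) ->
  tnorm m f <= M + M.
Proof.
move=> M0 HM; apply: seminorm_le; first exact: addr_ge0.
move=> y a _ am; rewrite (le_trans (absc_le_ReIm _)) //.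
by have := HM (word_of a) _ y; rewrite size_word_of => /(_ am) [? ?]; rewrite lerD.
Qed.

Lemma taylor_term1 (g : V -> R) p h :
  taylor_term 1 g p h = \sum_(i < n) h 0 i * dword_re [:: i] g p.
Proof.
rewrite /taylor_term /= big_flatten big_map big_enum /=; apply: eq_bigr => i _.
by rewrite big_seq1 /word_mono big_seq1.
Qed.

(** Taylor's formula of degree 0, for every derivative of phi. *)
Lemma iota_lipschitz phi x : Uc O (phi, x) -> exists (c d : R), [/\ 0 <= c, 0 < d &
  forall h, `|h| <= d -> absc (slice (iota_c u) phi (x + h) - slice (iota_c u) phi x)
    <= c * `|h|].
Proof.
move=> px; have [d [K [d0 cK KO HK]]] := local_translates px.
have [N [m [N0 HN]]] := pairing_bound cK KO.
have [/= tp _ _] := px; have [[sr si] _ _] := tp.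
have [M M0 HM] := test_words_bounded m.+1 tp.
exists (N * ((n ^ 1)%:R * M + (n ^ 1)%:R * M)), d; split => //.
  by rewrite mulr_ge0 // addr_ge0 // mulr_ge0.
move=> h hd; have [ph sh] := HK h hd; have := HK 0; rewrite normr0 => /(_ (ltW d0)).
rewrite addr0 => -[_ s0].
have [/= _ _ sO] := px; have [/= _ _ shO] := ph.
have t0 : test O (fun y => phi (y - x)) by exact: test_shift.
have th : test O (fun y => phi (y - (x + h))) by exact: test_shift.
have cK' : closed K by apply: compact_closed => //; exact: norm_hausdorff.
set g0 := fun y => phi (y - x) in t0 s0; set gh := fun y => phi (y - (x + h)) in th sh.
have sl : supp (real_comb (-1) g0 gh) `<=` K by exact: supp_real_comb.
have tl : test O (real_comb (-1) g0 gh).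
  split; [by apply: smooth_real_comb; [case: t0|case: th]| |exact: subset_trans sl KO].
  by apply: (subclosed_compact _ cK sl); exact: closed_closure.
rewrite (slice_iota ph) (slice_iota px) -/g0 -/gh.
have -> : pairing gh - pairing g0 = pairing (real_comb (-1) g0 gh).
  by rewrite pairing_real_comb // rmorphN1 mulN1r addrC.
rewrite (le_trans (HN _ tl sl)) // -mulrA ler_wpM2l // mulrDl.
apply: tnorm_le; first by rewrite !mulr_ge0.
have est (g : V -> R) : smooth_on_re setT g ->
   (forall w, (size w <= m.+1)%N -> forall x, `|dword_re w g x| <= M) ->
   forall w, (size w <= m)%N -> forall y,
   `|dword_re w (fun y => -1 * g (y - x) + g (y - (x + h))) y| <= (n ^ 1)%:R * M * `|h|.
  move=> sg gM w wm y.
  rewrite (dword_re_lin _ _ openT (smooth_on_re_shift x sg) (smooth_on_re_shift (x + h) sg)) //.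
  rewrite !dword_re_shift mulN1r addrC.
  have := @taylor _ _ setT (dword_re w g) (y - x) (- h) 0 `|h| M openT
    (smooth_dword w sg) _ _ _.
  rewrite big_ord1 taylor_term0 fact0 divr1 normrN opprD addrA expr1 => T.
  rewrite (_ : (n ^ 1)%:R * M * `|h| = (n ^ 1)%:R * (`|h| * M)); last by ring.
  apply: T => //.
  by move=> v sv s _; rewrite -dword_re_cat; apply: gM; rewrite size_cat sv.
move=> w wm y; rewrite re_real_comb im_real_comb; split.
  exact: (est (re phi) sr (fun v vm z => (HM v vm z).1) w wm y).
exact: (est (im phi) si (fun v vm z => (HM v vm z).2) w wm y).
Qed.


(** Taylor's formula of degree 1, for every derivative of phi; Schwarz's theorem
    identifies the linear term with a derivative of the partial derivative of
    phi. *)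
Lemma iota_difference phi x i : Uc O (phi, x) -> exists (c d : R), [/\ 0 <= c, 0 < d &
  forall t : R, t != 0 -> `|t| <= d ->
  absc (t^-1%:C * (slice (iota_c u) phi (x + t *: d_ i) - slice (iota_c u) phi x)
        + slice (iota_c u) (dword [:: i] phi) x) <= c * `|t|].
Proof.
move=> px; have [d [K [d0 cK KO HK]]] := local_translates px.
have [N [m [N0 HN]]] := pairing_bound cK KO.
have [/= tp _ _] := px; have [[sr si] _ _] := tp.
have [M M0 HM] := test_words_bounded m.+2 tp.
exists (N * ((n ^ 2)%:R * M + (n ^ 2)%:R * M)), d; split => //.
  by rewrite mulr_ge0 // addr_ge0 // mulr_ge0.
move=> t tn0 td; pose h := t *: d_ i.
have di1 : `|d_ i| <= 1.
  apply: row_norm_le => // j; rewrite mxE eqxx /=.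
  by case: eqP => _; rewrite ?normr1 ?normr0.
have ht : `|h| <= `|t| by rewrite normrZ ler_piMr.
have hd : `|h| <= d := le_trans ht td.
have [ph sh] := HK h hd; have := HK 0; rewrite normr0 => /(_ (ltW d0)).
rewrite addr0 => -[_ s0].
have pdx := pairs_dword [:: i] px.
have [/= _ _ sO] := px; have [/= _ _ shO] := ph; have [/= tdp _ sdO] := pdx.
have t0 : test O (fun y => phi (y - x)) by exact: test_shift.
have th : test O (fun y => phi (y - (x + h))) by exact: test_shift.
have td' : test O (fun y => dword [:: i] phi (y - x)) by exact: test_shift.
have sd : supp (fun y => dword [:: i] phi (y - x)) `<=` K.
  rewrite supp_shift; apply: subset_trans s0; rewrite supp_shift => _ [z /supp_dword sz <-].
  by exists z.
have cK' : closed K by apply: compact_closed => //; exact: norm_hausdorff.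
set g0 := fun y => phi (y - x) in t0 s0; set gh := fun y => phi (y - (x + h)) in th sh.
set gd := fun y => dword [:: i] phi (y - x) in td' sd.
have testK f : smooth_on setT f -> supp f `<=` K -> test O f.
  move=> sf fK; split => //; last exact: subset_trans fK KO.
  by apply: (subclosed_compact _ cK fK); exact: closed_closure.
have [sm0 _ _] := t0; have [smh _ _] := th; have [smd _ _] := td'.
have sl : supp (real_comb (-1) g0 gh) `<=` K by exact: supp_real_comb.
have sml := smooth_real_comb (-1) sm0 smh.
have tl := testK _ sml sl.
have sl2 : supp (real_comb t^-1 (real_comb (-1) g0 gh) gd) `<=` K by exact: supp_real_comb.
have sml2 := smooth_real_comb t^-1 sml smd.
have tl2 := testK _ sml2 sl2.
rewrite (slice_iota ph) (slice_iota px) (slice_iota pdx) -/g0 -/gh -/gd.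
have -> : t^-1%:C * (pairing gh - pairing g0) + pairing gd =
    pairing (real_comb t^-1 (real_comb (-1) g0 gh) gd).
  by rewrite !pairing_real_comb // rmorphN1 mulN1r [- _ + _]addrC.
rewrite (le_trans (HN _ tl2 sl2)) // -mulrA ler_wpM2l // mulrDl.
apply: tnorm_le; first by rewrite !mulr_ge0.
have est (g : V -> R) : smooth_on_re setT g ->
   (forall w, (size w <= m.+2)%N -> forall x, `|dword_re w g x| <= M) ->
   forall w, (size w <= m)%N -> forall y,
   `|dword_re w (fun y => t^-1 * (-1 * g (y - x) + g (y - (x + h)))
       + dword_re [:: i] g (y - x)) y| <= (n ^ 2)%:R * M * `|t|.
  move=> sg gM w wm y.
  have s1 := smooth_on_re_shift x sg; have s2 := smooth_on_re_shift (x + h) sg.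
  have s3 := smooth_on_re_shift x (smooth_dword [:: i] sg).
  rewrite (dword_re_lin _ _ openT (smooth_lin (-1) openT s1 s2) s3) //.
  rewrite (dword_re_lin _ _ openT s1 s2) // !dword_re_shift mulN1r -dword_re_cat.
  rewrite (@dword_re_perm _ _ setT g (w ++ [:: i]) (i :: w) _ openT sg) //; last first.
    by rewrite perm_catC.
  have := @taylor _ _ setT (dword_re w g) (y - x) (- h) 1 `|t| M openT
    (smooth_dword w sg) _ _ _.
  rewrite big_ord_recl big_ord1 taylor_term0 !fact0 !divr1 normrN => T.
  have {}T := T ht (fun _ _ => I).
  rewrite [taylor_term _ _ _ _](_ : _ = - t * dword_re (i :: w) g (y - x)) in T; last first.
    rewrite /= taylor_term1 (bigD1 i) //= big1 ?addr0 => [|j /negbTE ji].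
      by rewrite !mxE !eqxx mulr1.
    by rewrite !mxE ji andbF mulr0 oppr0 mul0r.
  rewrite opprD addrA; apply: diffquot_le => //; apply: T.
  by move=> v sv s _; rewrite -dword_re_cat; apply: gM; rewrite size_cat sv.
move=> w wm y; rewrite !re_real_comb !im_real_comb; split.
  exact: (est (re phi) sr (fun v vm z => (HM v vm z).1) w wm y).
exact: (est (im phi) si (fun v vm z => (HM v vm z).2) w wm y).
Qed.

(** The real and the imaginary part of the slices are treated alike. *)
Section Part.
Variables (part : C -> R).
Hypothesis part_le : forall z, `|part z| <= absc z.
Hypothesis partD : forall z z', part (z + z') = part z + part z'.
Hypothesis partZ : forall (k : R) z, part (k%:C * z) = k * part z.

Lemma partB z z' : part (z - z') = part z - part z'.
Proof.
rewrite partD; congr (_ + _); rewrite -mulN1r.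
by rewrite (_ : -1 = (-1 : R)%:C) ?partZ ?mulN1r // rmorphN1.
Qed.

Definition part_slice phi : V -> R := fun x => part (slice (iota_c u) phi x).

Lemma continuous_part_slice phi x : Uc O (phi, x) -> {for x, continuous (part_slice phi)}.
Proof.
move=> px; have [c [d [c0 d0 H]]] := iota_lipschitz px.
apply/(@cvgrPdist_le _ _ _ (nbhs x)) => e e0.
have r0 : 0 < Num.min d (e / (c + 1)) by rewrite lt_min d0 divr_gt0 // ltr_wpDl.
apply: filterS (nbhsx_ballx x _ r0) => y; rewrite -ball_normE /ball_ /= lt_min.
rewrite distrC => /andP[/ltW yd /ltW yc].
have := H (y - x) yd; rewrite [x + _]addrC subrK => Hy.
rewrite distrC /part_slice -partB (le_trans (part_le _)) // (le_trans Hy) //.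
rewrite (@le_trans _ _ ((c + 1) * `|y - x|)) ?ler_wpM2r ?lerDl //.
by rewrite mulrC -ler_pdivlMr // ltr_wpDl.
Qed.

Lemma is_derive_part_slice phi x i : Uc O (phi, x) ->
  is_derive x (d_ i) (part_slice phi) (- part_slice (dword [:: i] phi) x).
Proof.
move=> px; have [c [d [c0 d0 H]]] := iota_difference i px.
suff cv : (h^-1 *: ((part_slice phi \o shift x) (h *: d_ i) - part_slice phi x)) @[h --> 0^'] -->
    - part_slice (dword [:: i] phi) x.
  apply: DeriveDef; first by apply/cvg_ex; eexists; exact: cv.
  exact: cvg_lim cv.
apply/cvgrPdist_le => /= e e0; near=> t.
have t0 : t != 0 by near: t; exact: nbhs_dnbhs_neq.
have td : `|t| <= d.
  by apply: ltW; rewrite -[`|t|]mulr1; near: t; exact: near_mul_lt.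
have tc : `|t| * c <= e by apply: ltW; near: t; exact: near_mul_lt.
have := H t t0 td; rewrite [c * _]mulrC => Ht.
rewrite -[_ *: _]/(_ * _) /part_slice -partB -partZ -opprD -partD normrN addrC [_ + x]addrC.
by rewrite (le_trans (part_le _)) // (le_trans _ tc).
Unshelve. all: by end_near. Qed.

(** The variable x enters through phi(. - x), so each derivative falls on phi and
    changes the sign. *)
Lemma dword_re_part_slice phi w x : Uc O (phi, x) ->
  dword_re w (part_slice phi) x = (-1) ^+ size w * part_slice (dword w phi) x.
Proof.
move=> px; have oW : open [set y | Uc O (phi, y)].
  by apply: open_pairs => //; have [/= [_ ? _] _ _] := px.
elim: w x px => [|i w IH] x px.
  rewrite expr0 mul1r /part_slice; congr (part (slice _ _ x)).
  by apply/funext => y; apply: complex_ext.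
rewrite /= (@near_eq_derive _ _ _ _ ((-1) ^+ size w \*: part_slice (dword w phi))); last first.
  exact: (near_open oW px).
have dw := is_derive_part_slice i (pairs_dword w px).
rewrite deriveZ; last by have [] := dw.
by have [_ ->] := dw; rewrite exprS mulN1r mulNr -[_ *: _]/(_ * _) mulrN.
Qed.

Lemma smooth_part_slice phi : test setT phi ->
  smooth_on_re [set x | Uc O (phi, x)] (part_slice phi).
Proof.
move=> tp w x px; have oW : open [set y | Uc O (phi, y)].
  by apply: open_pairs => //; case: tp.
have nE : \forall y \near x,
    ((-1) ^+ size w \*: part_slice (dword w phi)) y = dword_re w (part_slice phi) y.
  by apply: (near_open oW px) => y py; rewrite dword_re_part_slice.
have pw := pairs_dword w px; split.
  apply: continuous_near_eq nE _; apply: continuousZl_tmp.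
  exact: continuous_part_slice.
move=> i; apply: near_eq_derivable nE _; apply: derivableZ.
by have [] := is_derive_part_slice i pw.
Qed.

End Part.

Lemma iota_c_smooth : Bc (iota_c u).
Proof.
move=> phi tp; split.
  apply: (smooth_part_slice (part := @complex.Re R)) tp => //.
  - exact: Re_le_absc.
  - by case=> a b [].
  - exact: Re_realM.
apply: (smooth_part_slice (part := @complex.Im R)) tp => //.
- exact: Im_le_absc.
- by case=> a b [].
- exact: Im_realM.
Qed.

End Distribution.
End Embeddings.

Theorem proposition37 (R : realType) (n : nat) (Omega : set 'rV[R]_n)
    (openOmega : open Omega) :
  [/\ forall F : Uc Omega -> R[i], Bc F -> Ee (restrict_e F),
      forall u : test Omega -> R[i], distribution u ->
        Bc (iota_c u) /\ restrict_e (iota_c u) = iota_e u,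
      forall f : 'rV[R]_n -> R[i], smooth_on Omega f ->
        Bc (sigma_c Omega f) /\
        restrict_e (sigma_c Omega f) = sigma_e Omega f,
      forall F : Uc Omega -> R[i], Mc F -> EeM (restrict_e F) &
      forall F : Uc Omega -> R[i], Nc F -> Ne (restrict_e F)].
Proof.
split.
- by move=> F; exact: restrict_e_smooth.
- by move=> u du; split; [exact: iota_c_smooth|exact: restrict_iota].
- by move=> f sf; split; [exact: sigma_c_smooth|exact: restrict_sigma].
- by move=> F; exact: Mc_restrict.
- by move=> F; exact: Nc_restrict.
Qed.
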